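(* Let $k\ge1$ and $n-k\ge2$. The poset $\hat P_{n,k}$ obtained from $P_{n,k}$ by adjoining a minimum element $\hat 0$ is Eulerian, i.e. it is graded and every interval $[x,y]$ of rank greater than one has equally many elements of even rank and of odd rank.
   Context: Matroids on $[n]$ are given by their bases. Positroids are matroids of points of totally nonnegative Grassmannians; $Q_{n,k}$ is the poset of rank $k$ positroids on $[n]$ under inclusion; $\mathrm{env}(\mathcal M)$ is the smallest positroid containing $\mathcal M$. For a rank $k$ matroid $\mathcal M$, $\mathcal M^*=\{[n]\setminus J:J\in\mathcal M\}$ and $\mathcal M^{\downarrow2}=\{I\in\binom{[n]}{2}: I\subset J\text{ for some }J\in\mathcal M^*\}$. $P_{n,k}$ is the subposet of $Q_{n,2}$ (ordered by inclusion) consisting of the positroids $\mathrm{env}(\mathcal M^{\downarrow2})$ with $\mathcal M\in Q_{n,k}$. (It is graded of height $2k$.) *)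

(* Defs.v *)
From HB Require Import structures.
From mathcomp Require Import all_boot all_order all_algebra.
From mathcomp Require Import boolp reals.

Set Implicit Arguments.
Unset Strict Implicit.
Unset Printing Implicit Defensive.

Import Order.DefaultSetSubsetOrder.
Import Order.TTheory GRing.Theory Num.Theory.
Local Open Scope ring_scope.

Section EulerianPosets.
Context {d : Order.disp_t} {T : finPOrderType d}.

Definition chain (C : {set T}) : bool :=
  [forall x in C, forall y in C, (x >=< y)%O].

Definition graded : Prop :=
  forall C D : {set T}, maxset chain C -> maxset chain D -> #|C| = #|D|.

(* Length of a longest chain with top x; on a graded poset this is the
   rank function. *)
Definition rank (x : T) : nat :=
  (\max_(C : {set T} | chain C && [forall z in C, (z <= x)%O]) #|C|).-1.

Definition interval_set (x y : T) : {set T} := [set z | (x <= z <= y)%O].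

Definition interval_rank (x y : T) : nat := (rank y - rank x)%N.

End EulerianPosets.

Arguments graded {d} T.

Definition eulerian {d : Order.disp_t} (T : finPOrderType d) : Prop :=
  graded T /\
  forall x y : T, (x <= y)%O -> (1 < interval_rank x y)%N ->
    #|[set z in interval_set x y | ~~ odd (rank z)]| =
    #|[set z in interval_set x y | odd (rank z)]|.

(* The new minimum element is [None]. *)
Definition with_bot (T : Type) : Type := option T.

Section WithBot.
Context {d : Order.disp_t} {T : finPOrderType d}.

HB.instance Definition _ := Finite.on (with_bot T).

Definition with_bot_le (x y : with_bot T) : bool :=
  match x, y with
  | None, _ => true
  | Some _, None => false
  | Some a, Some b => (a <= b)%O
  end.

Fact with_bot_le_refl : reflexive with_bot_le.
Proof. by case=> //= a; exact: lexx. Qed.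

Fact with_bot_le_anti : antisymmetric with_bot_le.
Proof. by move=> [a|] [b|] //= /le_anti ->. Qed.

Fact with_bot_le_trans : transitive with_bot_le.
Proof. by move=> [b|] [a|] [c|] //=; exact: le_trans. Qed.

HB.instance Definition _ := Order.Le_isPOrder.Build d (with_bot T)
  with_bot_le_refl with_bot_le_anti with_bot_le_trans.

End WithBot.

Section Positroids.
Variables (R : realType) (n : nat).

Definition increasing k (f : {ffun 'I_k -> 'I_n}) : bool :=
  [forall i : 'I_k, forall j : 'I_k, (i < j)%N ==> (f i < f j)%N].

(* A point of the Grassmannian is the row space of a full-rank k x n matrix;
   its Pluecker coordinates are the minors on increasing sequences of
   columns. *)
Definition plucker k (A : 'M[R]_(k, n)) (f : {ffun 'I_k -> 'I_n}) : R :=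
  \det (colsub f A).

Definition tnn k (A : 'M[R]_(k, n)) : Prop :=
  row_free A /\ forall f, increasing f -> 0 <= plucker A f.

Definition bases k (A : 'M[R]_(k, n)) : {set {set 'I_n}} :=
  [set [set f i | i : 'I_k] | f : {ffun 'I_k -> 'I_n} &
     increasing f && (plucker A f != 0)].

Definition positroid (k : nat) (M : {set {set 'I_n}}) : Prop :=
  exists2 A : 'M[R]_(k, n), tnn A & bases A = M.

Definition is_env (k : nat) (M E : {set {set 'I_n}}) : Prop :=
  [/\ positroid k E, M \subset E &
      forall E', positroid k E' -> M \subset E' -> E \subset E'].

Definition dual_matroid (M : {set {set 'I_n}}) : {set {set 'I_n}} :=
  [set ~: J | J : {set 'I_n} in M].

Definition down2 (M : {set {set 'I_n}}) : {set {set 'I_n}} :=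
  [set I : {set 'I_n} | (#|I| == 2)%N &
     [exists J in dual_matroid M, I \subset J]].

Definition inP (k : nat) (E : {set {set 'I_n}}) : bool :=
  `[< exists2 M, positroid k M & is_env 2 (down2 M) E >].

Definition Pnk (k : nat) : Type := {E : {set {set 'I_n}} | inP k E}.

HB.instance Definition _ k := Finite.on (Pnk k).
HB.instance Definition _ k := SubFinite.on (Pnk k).
HB.instance Definition _ k := [SubChoice_isSubPOrder of Pnk k by <:
  with Order.SetSubsetOrder.subset_display].

Definition Phat (k : nat) := with_bot (Pnk k).
HB.instance Definition _ k := Order.FinPOrder.on (Phat k).

End Positroids.

(* Main.v *)
Require Import Defs.
From mathcomp Require Import all_boot all_order all_algebra.
From mathcomp Require Import boolp reals.
From mathcomp Require Import perm zify ring.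

Set Implicit Arguments.
Unset Strict Implicit.
Unset Printing Implicit Defensive.

Import Order.TTheory GRing.Theory Num.Theory.

(**
A rank 2 positroid on the cyclically ordered set [n] amounts to a set T of
nonloops split into parallel classes that are cyclic intervals of T; it is coded
by the pair (T, D), where D is the set of last elements of the classes.  A basis
J of the dual of M meets each class of env(M^{down 2}) at most once, so that
|D| >= n - k; conversely, the uniform matroid of rank n - k on the classes is
realised by Vandermonde minors, and its dual is a positroid M.  So P_{n,k} is the
set of pairs D \subset T with |D| >= n - k, the order says that whenever D meets
a cyclic interval [i, j) with ends in T, so does D', and the rank is
|T| + |D| - 2(n - k) + 1.

For x < y the parity is reversed by an involution of [x, y].  If T_x = T_y, add
or remove a fixed cut d in D_y \ D_x.  Otherwise some s in T_x is immediately
followed in T_y by some e not in T_x.  If s is not a cut of y, then s and e are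
parallel in y: add or remove e, letting it take over the role of s as a cut.  If
s is a cut of y, add or remove e when e is not a cut of z, and toggle the cut s
otherwise.  On [0, y], let F be the set of first elements of the classes of y:
toggle in T an element of F \ D_z that depends only on D_z.  The only z with
F \subset D_z is (F, F), which is matched with 0.
*)

(** * Posets with parity-reversing involutions *)

Section EulerianCriterion.
Context {disp : Order.disp_t} {P : finPOrderType disp}.
Variables (rho : P -> nat) (bot top : P).
Hypothesis le_bot : forall x, (bot <= x)%O.
Hypothesis le_top : forall x, (x <= top)%O.
Hypothesis rho_bot : rho bot = 0.
Hypothesis rho_lt : forall x y, (x < y)%O -> rho x < rho y.
Hypothesis rho_step : forall x y, (x < y)%O ->
  exists z, [/\ (x < z)%O, (z <= y)%O & rho z = (rho x).+1].

Lemma chain_comparable (C : {set P}) x y :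
  chain C -> x \in C -> y \in C -> (x >=< y)%O.
Proof. by move=> /forall_inP cC xC yC; move/forall_inP: (cC x xC); apply. Qed.

Lemma rho_le x y : (x <= y)%O -> rho x <= rho y.
Proof.
by rewrite le_eqVlt => /predU1P[->//|/rho_lt/ltnW].
Qed.

Lemma chain_le_rho (C : {set P}) x y :
  chain C -> x \in C -> y \in C -> rho x <= rho y -> (x <= y)%O.
Proof.
move=> cC xC yC; case/orP: (chain_comparable cC xC yC) => //.
by rewrite le_eqVlt => /predU1P[->//|/rho_lt]; rewrite ltnNge => /negP.
Qed.

Lemma chain_rho_inj (C : {set P}) : chain C -> {in C &, injective rho}.
Proof.
move=> cC x y xC yC e; apply/le_anti.
by rewrite !(chain_le_rho cC) // e.
Qed.

Lemma chain_card_le (C : {set P}) x :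
  chain C -> {in C, forall z, (z <= x)%O} -> #|C| <= (rho x).+1.
Proof.
move=> cC Cx.
have rlt z : z \in C -> rho z < (rho x).+1 by move=> /Cx/rho_le.
pose f z : 'I_(rho x).+1 := inord (rho z).
have fi : {in C &, injective f}.
  move=> z t zC tC /(congr1 val); rewrite /= !inordK ?rlt //.
  exact: (chain_rho_inj cC zC tC).
by rewrite -(card_in_imset fi) (leq_trans (max_card _)) ?card_ord.
Qed.

Lemma maxchain_in (C : {set P}) z :
  maxset chain C -> {in C, forall w, (w >=< z)%O} -> z \in C.
Proof.
case/maxsetP=> cC maxC Cz; rewrite -(maxC (z |: C)) ?setU11 ?subsetUr //.
apply/forall_inP => a /setU1P[->|aC]; apply/forall_inP => b /setU1P[->|bC] //.
- exact: comparablexx.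
- by rewrite comparable_sym Cz.
- exact: Cz.
- exact: chain_comparable cC aC bC.
Qed.

(** Between a member of rank [i] and the member of least rank above [i], [rho_step] provides an
    element of rank [i + 1]. It is comparable with all of [C], so maximality puts it into [C]. *)
Lemma maxchain_rho_surj (C : {set P}) i :
  maxset chain C -> i <= rho top -> exists2 x, x \in C & rho x = i.
Proof.
move=> mC; have cC := maxsetp mC.
have topC : top \in C by apply: maxchain_in => // w _; rewrite /Order.comparable le_top.
elim: i => [_|i IHi lti].
  by exists bot => //; apply: maxchain_in => // w _; rewrite /Order.comparable le_bot orbT.
have [x xC rx] := IHi (ltnW lti).
have Pt : (top \in C) && (i < rho top) by rewrite topC.
have [y /andP[yC iy] ymin] := @arg_minnP _ top (fun w => (w \in C) && (i < rho w)) rho Pt.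
have xy : (x < y)%O.
  rewrite lt_neqAle (chain_le_rho cC) ?rx 1?ltnW // andbT.
  by apply/eqP => exy; move: iy; rewrite -exy rx ltnn.
have [z [xz zy rz]] := rho_step xy.
exists z; last by rewrite rz rx.
apply: maxchain_in => // w wC; rewrite /Order.comparable.
case: (leqP (rho w) i) => [wi|iw].
  by rewrite (le_trans _ (ltW xz)) // (chain_le_rho cC) // rx.
rewrite (le_trans zy) ?orbT // (chain_le_rho cC) //.
by rewrite ymin // wC.
Qed.

(** [C] has a member of each rank from 0 to [rho x], and in a chain those lie below [x]. *)
Lemma maxchain_card (C : {set P}) x : maxset chain C -> x \in C ->
  (rho x).+1 <= #|[set z in C | (z <= x)%O]|.
Proof.
move=> mC xC; set B := [set z in C | _].
have sub : [set: 'I_(rho x).+1] \subset [set inord (rho z) | z in B].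
  apply/subsetP => i _.
  have [|z zC rz] := @maxchain_rho_surj C i mC.
    by rewrite (leq_trans _ (rho_le (le_top x))) // -ltnS.
  apply/imsetP; exists z; last by apply: val_inj; rewrite /= rz inordK.
  by rewrite inE zC (chain_le_rho (maxsetp mC)) // rz -ltnS.
by have := leq_trans (subset_leq_card sub) (leq_imset_card _ _); rewrite cardsT card_ord.
Qed.

Lemma rank_rho x : rank x = rho x.
Proof.
rewrite /rank; suff -> : \max_(C : {set P} | chain C && [forall z in C, (z <= x)%O]) #|C| = (rho x).+1.
  by [].
apply/eqP; rewrite eqn_leq; apply/andP; split.
  by apply/bigmax_leqP => C /andP[cC /forall_inP Cx]; apply: chain_card_le.
have cx : chain [set x].
  by apply/forall_inP=> a /set1P->; apply/forall_inP=> b /set1P->; exact: comparablexx.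
have [C mC sC] := maxset_exists cx.
have xC : x \in C by rewrite (subsetP sC) ?inE.
apply: leq_trans (maxchain_card mC xC) _.
apply: (@leq_bigmax_cond _ _ (fun C : {set P} => #|C|)).
apply/andP; split; last by apply/forall_inP => z; rewrite inE => /andP[].
apply/forall_inP => a; rewrite inE => /andP[aC _].
apply/forall_inP => b; rewrite inE => /andP[bC _].
exact: chain_comparable (maxsetp mC) aC bC.
Qed.

Lemma graded_rho : graded P.
Proof.
suff H (C : {set P}) : maxset chain C -> #|C| = (rho top).+1.
  by move=> C D mC mD; rewrite !H.
move=> mC; apply/eqP; rewrite eqn_leq chain_card_le ?(maxsetp mC) //=.
have topC : top \in C by apply: maxchain_in => // w _; rewrite /Order.comparable le_top.
apply: leq_trans (maxchain_card mC topC) (subset_leq_card _).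
by apply/subsetP=> z; rewrite inE => /andP[].
Qed.

(** Inside the interval [psi] injects the even elements into the odd ones and conversely. It may
    depend on the interval and is constrained only there. *)
Lemma eulerian_of_involutions :
  (forall x y, (x < y)%O -> exists psi : P -> P, forall z, (x <= z <= y)%O ->
     [/\ (x <= psi z <= y)%O, psi (psi z) = z & odd (rho (psi z)) = ~~ odd (rho z)]) ->
  eulerian P.
Proof.
move=> inv; split; first exact: graded_rho.
move=> x y; rewrite le_eqVlt => /predU1P[->|xy _]; first by rewrite /interval_rank subnn.
have [psi psiP] := inv _ _ xy.
have le (b : bool) : #|[set z in interval_set x y | odd (rank z) == b]| <=
                     #|[set z in interval_set x y | odd (rank z) == ~~ b]|.
  set A := [set z in _ | _].
  have psi_inj : {in A &, injective psi}.
    move=> z t; rewrite !inE => /andP[zI _] /andP[tI _] e.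
    by have [_ <- _] := psiP z zI; have [_ <- _] := psiP t tI; rewrite e.
  rewrite -(card_in_imset psi_inj); apply/subset_leq_card/subsetP => _ /imsetP[z zA ->].
  move: zA; rewrite !inE !rank_rho => /andP[zI /eqP oz].
  by have [-> _ ->] := psiP z zI; rewrite oz eqxx.
have E (b : bool) : [set z in interval_set x y | odd (rank z) == b] =
   [set z in interval_set x y | if b then odd (rank z) else ~~ odd (rank z)].
  by apply/setP => z; rewrite !inE; case: b; case: (odd _).
by apply/eqP; rewrite eqn_leq; have := le false; have := le true; rewrite !E => -> ->.
Qed.

End EulerianCriterion.

(** * Codes of rank 2 positroids *)

Section Toggle.
Variable T : finType.
Implicit Types A : {set T}.

Definition toggle (e : T) (A : {set T}) : {set T} :=
  [set m | if m == e then e \notin A else m \in A].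

Lemma toggleK e : involutive (toggle e).
Proof. by move=> A; apply/setP => m; rewrite !inE eqxx; case: eqP => // ->; rewrite negbK. Qed.

Lemma toggle_id e A : (e \in toggle e A) = (e \notin A).
Proof. by rewrite inE eqxx. Qed.

Lemma toggle_neq e m A : m != e -> (m \in toggle e A) = (m \in A).
Proof. by rewrite inE => /negPf->. Qed.

Lemma card_toggle_notin e A : e \notin A -> #|toggle e A| = #|A|.+1.
Proof.
move=> eA; have -> : toggle e A = e |: A.
  by apply/setP => m; rewrite !inE; case: eqP.
by rewrite cardsU1 eA.
Qed.

Lemma odd_card_toggle e A : odd #|toggle e A| = ~~ odd #|A|.
Proof.
case: (boolP (e \in A)) => eA; last by rewrite card_toggle_notin.
have := @card_toggle_notin e (toggle e A).
by rewrite toggleK toggle_id eA => /(_ isT) ->; rewrite /= negbK.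
Qed.

Definition swap (s e : T) (A : {set T}) : {set T} := [set m | tperm s e m \in A].

Lemma swapK s e : involutive (swap s e).
Proof. by move=> A; apply/setP=> m; rewrite !inE tpermK. Qed.

Lemma card_swap s e A : #|swap s e A| = #|A|.
Proof. by rewrite -[RHS](card_preimset _ (@perm_inj _ (tperm s e))); apply: eq_card => m; rewrite !inE. Qed.

End Toggle.

(** * Cyclic intervals and consecutive elements *)

Section CyclicArcs.

(* The cyclic half-open interval [i, j), which is everything when i = j. *)
Definition cyc_arc (i j m : nat) : bool :=
  (i <= m) && (m < j) || (j <= i) && ((i <= m) || (m < j)).

Variable n : nat.
Implicit Types (A B D T : {set 'I_n}) (i j m s e : 'I_n).

(** The cardinality of [cyc_arc i j]; in particular [dist i i] is [n], not 0. *)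
Definition dist i j : nat := if i < j then j - i else j + n - i.

Lemma arc_refl i j : cyc_arc i j i.
Proof. by rewrite /cyc_arc; lia. Qed.

Lemma arc_id i m : cyc_arc i i m.
Proof. by rewrite /cyc_arc; lia. Qed.

Lemma arc_end i j : i != j -> ~~ cyc_arc i j j.
Proof. by rewrite /cyc_arc -val_eqE /=; lia. Qed.

Lemma arc_dist_l s e m : cyc_arc s e m -> m != s -> dist m e < dist s e.
Proof.
move: (ltn_ord s) (ltn_ord e) (ltn_ord m); rewrite /cyc_arc /dist -val_eqE /=.
by repeat case: ifP; lia.
Qed.

Lemma arc_dist_r s e m : cyc_arc s e m -> m != s -> dist s m < dist s e.
Proof.
move: (ltn_ord s) (ltn_ord e) (ltn_ord m); rewrite /cyc_arc /dist -val_eqE /=.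
by repeat case: ifP; lia.
Qed.

(** For [s] and [e] in [T], [e] is the cyclic successor of [s] in [T]; when [s = e], this means that
    [T] is a singleton. *)
Definition adjacent T s e := forall m, m \in T -> cyc_arc s e m -> m = s.

(** Take a pair at minimal cyclic distance: an element of [A] or [B] strictly in between would give
    a closer pair. *)
Lemma adjacentP A B s0 e0 : s0 \in A -> e0 \in B ->
  exists s e, [/\ s \in A, e \in B & adjacent (A :|: B) s e].
Proof.
move=> sA eB; have Pse : (s0, e0) \in setX A B by rewrite inE /= sA.
have [[s e]] := @arg_minnP _ (s0, e0) (fun p => p \in setX A B) (fun p => dist p.1 p.2) Pse.
rewrite inE /= => /andP[sA' eB'] Hmin; exists s, e; split => // m mT sem.
apply/eqP/negPn/negP => ms; case/setUP: mT => mT.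
  have := Hmin (m, e); rewrite inE /= mT eB' => /(_ isT).
  by rewrite leqNgt (arc_dist_l sem ms).
have := Hmin (s, m); rewrite inE /= mT sA' => /(_ isT).
by rewrite leqNgt (arc_dist_r sem ms).
Qed.

Lemma adjacentN T s e m : adjacent T s e -> m \in T -> m != s -> ~~ cyc_arc s e m.
Proof. by move=> a mT ms; apply/negP => /a /eqP; rewrite (negPf ms) => /(_ mT). Qed.

Lemma adjacent_arc T s e i : adjacent T s e -> i \in T -> i != e -> cyc_arc i e s.
Proof.
move=> a iT ie; have [->|si] := eqVneq i s; first by rewrite arc_refl.
have := adjacentN a iT si; move: ie si; rewrite /cyc_arc -!val_eqE /=; lia.
Qed.

Lemma adjacent_arc_end T s e i j :
  adjacent T s e -> j \in T -> j != e -> cyc_arc i j s -> cyc_arc i j e.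
Proof.
move=> a jT je; have [->|js] := eqVneq j s; first by rewrite /cyc_arc; lia.
have := adjacentN a jT js; move: je js; rewrite /cyc_arc -!val_eqE /=; lia.
Qed.

Lemma adjacent_arc_start T s e i j :
  adjacent T s e -> i \in T -> i != e -> cyc_arc i j e -> cyc_arc i j s.
Proof.
move=> a iT ie; have [->|si] := eqVneq i s; first by rewrite arc_refl.
have := adjacentN a iT si; move: ie si; rewrite /cyc_arc -!val_eqE /=; lia.
Qed.

Lemma adjacent_arc_tail T s e j m :
  adjacent T s e -> m \in T -> m != s -> cyc_arc s j m -> cyc_arc e j m.
Proof.
move=> a mT ms; have := adjacentN a mT ms; move: ms; rewrite /cyc_arc -!val_eqE /=; lia.
Qed.

Lemma adjacent_arc_init T s e i m :
  adjacent T s e -> i \in T -> m \in T -> i != e -> i != s -> m != s -> cyc_arc i e m -> cyc_arc i s m.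
Proof.
move=> a iT mT ie si ms; have := adjacentN a mT ms; have := adjacentN a iT si.
by move: ie si ms; rewrite /cyc_arc -!val_eqE /=; lia.
Qed.

Lemma adjacent_arc_widen T s e i m :
  adjacent T s e -> i \in T -> i != e -> i != s -> cyc_arc i s m -> cyc_arc i e m.
Proof.
move=> a iT ie si; have := adjacentN a iT si.
by move: ie si; rewrite /cyc_arc -!val_eqE /=; lia.
Qed.

Lemma arc_compl i j m : i != j -> ~~ cyc_arc j i m -> cyc_arc i j m.
Proof. by rewrite /cyc_arc -val_eqE /=; lia. Qed.

Lemma arc_trans_r i j m m' : cyc_arc i j m -> cyc_arc m j m' -> cyc_arc i j m'.
Proof. by rewrite /cyc_arc; lia. Qed.

Lemma arc_trans_l i j m m' : i != m -> cyc_arc i j m -> cyc_arc i m m' -> cyc_arc i j m'.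
Proof. by rewrite /cyc_arc -val_eqE /=; lia. Qed.

(** In the application [d] is a cut, [f] its successor and [t] a later element of the class that
    begins at [f]. This lemma and the next exclude from [[f, t)] the cut [d] and any other cut
    [m]. *)
Lemma arc_contra1 (d f t : 'I_n) : f != t -> cyc_arc f t d -> t != d -> f != d ->
  ~~ cyc_arc d f t -> False.
Proof. by rewrite /cyc_arc -!val_eqE /=; lia. Qed.

Lemma arc_contra2 (d f t m : 'I_n) : f != t -> cyc_arc f t m -> t != d -> f != d -> m != d ->
  ~~ cyc_arc d f t -> ~~ cyc_arc d t m -> False.
Proof. by rewrite /cyc_arc -!val_eqE /=; lia. Qed.

Definition meets D i j : bool := [exists d in D, cyc_arc i j d].

Lemma meetsP D i j : reflect (exists2 d, d \in D & cyc_arc i j d) (meets D i j).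
Proof. exact: exists_inP. Qed.

Lemma meets_in D i j d : d \in D -> cyc_arc i j d -> meets D i j.
Proof. by move=> dD ijd; apply/meetsP; exists d. Qed.

Lemma meets_sub D i j i' j' :
  (forall d : 'I_n, cyc_arc i j d -> cyc_arc i' j' d) -> meets D i j -> meets D i' j'.
Proof. by move=> H /meetsP[d dD /H]; exact: meets_in. Qed.

End CyclicArcs.

(** * Codes, their order, and the involutions on intervals *)

Section Codes.
Variable n : nat.
Implicit Types (x y z : {set 'I_n} * {set 'I_n}).

Definition code : Type := ({set 'I_n} * {set 'I_n})%type.

Definition code_le x y : Prop :=
  x.1 \subset y.1 /\
  {in x.1 &, forall i j, meets x.2 i j -> meets y.2 i j}.

Definition code_size x : nat := #|x.1| + #|x.2|.

Lemma code_le_refl x : code_le x x.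
Proof. by split. Qed.

(** The arc from a cut [d] to its successor in [T] contains no other element of [T], so if the cuts
    of [y] meet this arc, then [d] is one of them. *)
Lemma code_le_same x y : x.2 \subset x.1 -> y.2 \subset y.1 -> x.1 = y.1 ->
  code_le x y -> x.2 \subset y.2.
Proof.
move=> vx vy e [_ H]; apply/subsetP => d dx.
have dT := subsetP vx d dx.
have [s [j [/set1P-> jT a]]] := adjacentP (set11 d) dT.
have [|m mD dm] := meetsP _ _ _ (H d j dT jT _); first by apply: meets_in dx (arc_refl _ _).
by rewrite -(a m) // inE e (subsetP vy) ?orbT.
Qed.

Lemma code_le_meets x y j d : x.2 \subset x.1 -> code_le x y -> j \in x.1 -> d \in x.2 ->
  meets y.2 d j.
Proof.
move=> vx [_ H] jT dD; apply: (H _ _ (subsetP vx _ dD)) => //.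
exact: meets_in dD (arc_refl _ _).
Qed.

Lemma code_le_anti x y : x.2 \subset x.1 -> y.2 \subset y.1 ->
  code_le x y -> code_le y x -> x = y.
Proof.
move=> vx vy xy yx.
have e : x.1 = y.1 by apply/eqP; rewrite eqEsubset xy.1 yx.1.
have e2 : x.2 = y.2.
  by apply/eqP; rewrite eqEsubset (code_le_same vx vy) // (code_le_same vy vx).
by case: x y e e2 {vx vy xy yx} => [? ?] [? ?] /= -> ->.
Qed.

(** The lower bound on the number of cuts is left out: for codes above [x] it is inherited from [x]
    through [code_le_card]. *)
Definition reverses_parity x y (psi : code -> code) := forall z,
  z.2 \subset z.1 -> code_le x z -> code_le z y ->
  [/\ (psi z).2 \subset (psi z).1, code_le x (psi z) /\ code_le (psi z) y,
      psi (psi z) = z & odd (code_size (psi z)) = ~~ odd (code_size z)].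

(** An arc that ends at [e] passes through [s], a cut of [y]. Any other arc is shortened so as to
    start at a cut of [z] in it, which is not [e]. *)
Lemma code_le_toggle y z s e : z.2 \subset z.1 -> code_le z y ->
  s \in y.2 -> e \in y.1 -> adjacent y.1 s e -> e \notin z.2 ->
  z.2 \subset toggle e z.1 /\ code_le (toggle e z.1, z.2) y.
Proof.
move=> vz zy sy ey adj ez; have [zy1 zy2] := zy; split.
  apply/subsetP => m mz; rewrite toggle_neq ?(subsetP vz) //.
  by apply: contraNneq ez => <-.
have tT i : i \in toggle e z.1 -> i \in y.1.
  by rewrite inE; case: eqP => [-> //|_]; exact: (subsetP zy1).
split=> /=; first by apply/subsetP => i; exact: tT.
move=> i j iT jT /meetsP[d dz id].
have [je|je] := eqVneq j e; last first.
  have jz : j \in z.1 by rewrite toggle_neq in jT.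
  by apply: meets_sub (code_le_meets vz zy jz dz) => m; exact: arc_trans_r id.
have [ie|ie] := eqVneq i e.
  by apply: (meets_in sy); rewrite je ie arc_id.
by apply: (meets_in sy); rewrite je; exact: (adjacent_arc adj (tT _ iT)).
Qed.

Section Interval.
Variables x y : code.
Hypotheses (vx : x.2 \subset x.1) (vy : y.2 \subset y.1).
Hypotheses (lexy : code_le x y).

(** With [T] fixed, the order is inclusion of cut sets. *)
Lemma reverses_parity_cut d : x.1 = y.1 -> d \in y.2 -> d \notin x.2 ->
  reverses_parity x y (fun z => (z.1, toggle d z.2)).
Proof.
move=> e dy dx z vz xz zy.
have eT : z.1 = x.1 by apply/eqP; rewrite eqEsubset {1}e xz.1 zy.1.
have xz2 := code_le_same vx vz (esym eT) xz.
have zy2 := code_le_same vz vy (etrans eT e) zy.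
split => /=.
- apply/subsetP => m; rewrite inE; case: eqP => [->|_ /(subsetP vz)//].
  by rewrite eT e (subsetP vy).
- split; split => //=; rewrite ?eT ?e // => i j _ _.
    move=> /meetsP[m mx im]; apply: meets_in im.
    rewrite toggle_neq ?(subsetP xz2) //; by apply: contraNneq dx => <-.
  move=> /meetsP[m mx im]; apply: meets_in im.
  move: mx; rewrite inE; case: eqP => [->//|_]; exact: subsetP zy2 _.
- by rewrite toggleK; case: z {vz xz zy eT xz2 zy2}.
- by rewrite /code_size /= !oddD odd_card_toggle addbN.
Qed.

Variables s e : 'I_n.
Hypotheses (sx : s \in x.1) (ex : e \notin x.1) (ey : e \in y.1).
Hypothesis adj : adjacent y.1 s e.

Let neq_se : s != e. Proof. by apply: contraNneq ex => <-. Qed.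
Let x_neq_e i : i \in x.1 -> i != e. Proof. by apply: contraTneq => ->. Qed.


(** Neither move changes whether [e \in z.2], which makes the map an involution. If [e] is a cut of
    [z], it can stand in for [s]: an arc with ends in [x.1] that contains [s] also contains [e],
    because it does not end at [e]. *)
Lemma reverses_parity_first : s \in y.2 -> reverses_parity x y (fun z =>
  if e \in z.2 then (z.1, toggle s z.2) else (toggle e z.1, z.2)).
Proof.
move=> sy z vz xz zy; have [xz1 xz2] := xz; have [zy1 zy2] := zy.
have sz : s \in z.1 := subsetP xz1 _ sx.
have yT i : i \in x.1 -> i \in y.1 by exact: (subsetP lexy.1).
have zT i : i \in z.1 -> i \in y.1 by exact: (subsetP zy1).
case: ifPn => ez /=.
  rewrite toggle_neq 1?eq_sym // ez toggleK /code_size /= !oddD odd_card_toggle addbN.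
  split => //; last by case: z {vz xz zy xz1 xz2 zy1 zy2 sz zT ez}.
    by apply/subsetP => m; rewrite inE; case: eqP => [->|_ /(subsetP vz)].
  split; split => //= i j iT jT.
    move=> /(xz2 i j iT jT) /meetsP[d dz id].
    have [dd|ds] := eqVneq d s; last by apply: meets_in id; rewrite toggle_neq.
    apply: (@meets_in _ _ _ _ e); first by rewrite toggle_neq 1?eq_sym.
    by apply: (adjacent_arc_end adj) (yT _ jT) (x_neq_e jT) _; rewrite -dd.
  move=> /meetsP[d dz id]; have [dd|ds] := eqVneq d s; first by apply: (meets_in sy); rewrite -dd.
  by apply: zy2 => //; apply: meets_in id; rewrite toggle_neq in dz.
rewrite (negPf ez) toggleK /code_size /= !oddD odd_card_toggle addNb.
have [vt lt] := code_le_toggle vz zy sy ey adj ez.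
split => //; last by case: z {vz xz zy xz1 xz2 zy1 zy2 sz zT ez vt lt}.
split => //; split => //=.
by apply/subsetP=> i ix; rewrite toggle_neq ?(subsetP xz1) ?x_neq_e.
Qed.

(** As [s] is not a cut of [y], the elements [s] and [e] are parallel in [y], and only the later one
    present can be a cut of [z]. Swapping them in the cut set hands the cut over when [e] comes or
    goes. *)
Lemma reverses_parity_inner : s \notin y.2 -> reverses_parity x y (fun z =>
  (toggle e z.1, swap s e z.2)).
Proof.
move=> sy z vz xz zy; have [xz1 xz2] := xz; have [zy1 zy2] := zy.
have sz : s \in z.1 := subsetP xz1 _ sx.
have yT i : i \in x.1 -> i \in y.1 by exact: (subsetP lexy.1).
have zT i : i \in z.1 -> i \in y.1 by exact: (subsetP zy1).
have es : e != s by rewrite eq_sym.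
have sz2 : e \in z.1 -> s \notin z.2.
  move=> ez; apply/negP => sz2; have /meetsP[m my sem] := code_le_meets vz zy ez sz2.
  by move: sy; rewrite -(adj (subsetP vy _ my) sem) my.
have swE m : m \in swap s e z.2 = if m == s then e \in z.2 else
    if m == e then s \in z.2 else m \in z.2.
  by rewrite inE; case: tpermP => [->|->|/eqP/negPf-> /eqP/negPf->]; rewrite ?eqxx // (negPf es).
rewrite /= toggleK swapK /code_size /= !oddD odd_card_toggle card_swap addNb.
split => //; last by case: z {vz xz zy xz1 xz2 zy1 zy2 sz zT sz2 swE}.
  apply/subsetP => m; rewrite swE; have [->|ms] := eqVneq m s.
    by rewrite toggle_neq ?sz.
  have [->|me] := eqVneq m e; last by rewrite toggle_neq //; exact: (subsetP vz).
  by rewrite toggle_id; apply: contraL => /sz2.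
have tT i : i \in toggle e z.1 -> i \in y.1.
  by rewrite inE; case: eqP => [-> //|_]; exact: zT.
split; split => //=.
- by apply/subsetP=> i ix; rewrite toggle_neq ?(subsetP xz1) ?x_neq_e.
- move=> i j iT jT /(xz2 i j iT jT) /meetsP[d dz ijd].
  have [dd|ds] := eqVneq d s.
    apply: (@meets_in _ _ _ _ e); first by rewrite swE (negPf es) eqxx -dd.
    by apply: (adjacent_arc_end adj) (yT _ jT) (x_neq_e jT) _; rewrite -dd.
  have [dd|de] := eqVneq d e; last first.
    by apply: meets_in ijd; rewrite swE (negPf ds) (negPf de).
  apply: (@meets_in _ _ _ _ s); first by rewrite swE eqxx -dd.
  by apply: (adjacent_arc_start adj) (yT _ iT) (x_neq_e iT) _; rewrite -dd.
- by apply/subsetP => i; exact: tT.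
move=> i j iT jT /meetsP[d]; rewrite swE => dz ijd.
(* If [e] belongs to [z], it is being removed and is no end of an arc to be tested; otherwise it is
   new and may be one. *)
have [ee|ne] := boolP (e \in z.1).
  have iz : i \in z.1 by move: iT; rewrite inE ee; case: eqP.
  have jz : j \in z.1 by move: jT; rewrite inE ee; case: eqP.
  have je : j != e by apply: contraTneq jT => ->; rewrite toggle_id ee.
  have ie : i != e by apply: contraTneq iT => ->; rewrite toggle_id ee.
  apply: zy2 => //; have [dd|ds] := eqVneq d s.
    apply: (@meets_in _ _ _ _ e); first by rewrite dd eqxx in dz.
    by apply: (adjacent_arc_end adj) (zT _ jz) je _; rewrite -dd.
  have [dd|de] := eqVneq d e; last first.
    by apply: meets_in ijd; rewrite (negPf ds) (negPf de) in dz.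
  by move: dz; rewrite (negPf ds) dd eqxx (negPf (sz2 ee)).
have ez2 : e \notin z.2 by apply: contra ne; exact: (subsetP vz).
have {}dz : if d == e then s \in z.2 else (d != s) && (d \in z.2).
  move: dz; have [->|ds] := eqVneq d s; first by rewrite (negPf ez2).
  by case: eqP.
have zj : j != e -> j \in z.1 by move=> je; rewrite toggle_neq in jT.
have zi : i != e -> i \in z.1 by move=> je; rewrite toggle_neq in iT.
have [je|je] := eqVneq j e; last first.
  move: dz; have [dd dz|de /andP[ds dz]] := eqVneq d e; last first.
    apply: meets_sub (code_le_meets vz zy (zj je) dz) => m; exact: arc_trans_r.
  have [ie|ie] := eqVneq i e; last first.
    apply: zy2 (zi ie) (zj je) (meets_in dz _).
    by apply: (adjacent_arc_start adj (zT _ (zi ie)) ie); rewrite -dd.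
  (* The arc [[e, j)] is replaced by [[s, j)], whose ends are in [z.1]; the cut of [y] found there
     is not [s], so it lies in [[e, j)]. *)
  have /meetsP[m my sjm] := code_le_meets vz zy (zj je) dz.
  have ms : m != s by apply: contraNneq sy => <-.
  by apply: (meets_in my); rewrite ie; apply: adjacent_arc_tail adj (subsetP vy _ my) ms sjm.
have [ie|ie] := eqVneq i e.
  (* The arc from [e] to [e] is everything, so any cut of [y] will do. *)
  have [d' d'z] : exists d', d' \in z.2.
    by move: dz; case: eqP => [_ ?|_ /andP[_ ?]]; [exists s | exists d].
  have /meetsP[m my _] := code_le_meets vz zy sz d'z.
  by apply: (meets_in my); rewrite ie je arc_id.
have iez := zi ie.
move: dz ijd; rewrite je; have [->|de /andP[ds dz] ijd] := eqVneq d e.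
  by rewrite (negPf (arc_end ie)).
(* As [e] is not in [z.1], the order condition is applied to [[i, s)], which contains [d], and that
   arc is then widened to [[i, e)]. *)
have si : i != s.
  by apply: contraNneq ds => si; apply/eqP; apply: adj; rewrite -?si // zT // (subsetP vz).
have {ijd} isd : cyc_arc i s d.
  by apply: (adjacent_arc_init adj) ijd => //; apply: zT => //; exact: (subsetP vz).
apply: meets_sub (zy2 i s iez sz (meets_in dz isd)) => m.
exact: adjacent_arc_widen adj (zT _ iez) ie si.
Qed.

End Interval.

(** The value at [x] also yields an element one rank above [x], as [rho_step] requires. *)
Lemma parity_involution x y : x.2 \subset x.1 -> y.2 \subset y.1 ->
  code_le x y -> x != y -> x.1 != set0 ->
  exists2 psi, reverses_parity x y psi & code_size (psi x) = (code_size x).+1.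
Proof.
move=> vx vy xy; have [xy1 _] := xy; case: (eqVneq x.1 y.1) => [e1|ne1] neq /set0Pn[s0 s0x].
  have [d dy dx] : exists2 d, d \in y.2 & d \notin x.2.
    apply/subsetPn; apply: contra_neqN neq => yx.
    have e2 : x.2 = y.2 by apply/eqP; rewrite eqEsubset (code_le_same vx vy).
    by rewrite (surjective_pairing x) (surjective_pairing y) e1 e2.
  exists (fun z => (z.1, toggle d z.2)); first exact: reverses_parity_cut.
  by rewrite /code_size /= card_toggle_notin // addnS.
have [e0 e0y] : exists e, e \in y.1 :\: x.1.
  apply/set0Pn; rewrite setD_eq0; apply: contraNN ne1 => yx.
  by rewrite eqEsubset xy1.
have [s [e [sx /setDP[ey ex] adj]]] := adjacentP s0x e0y.
rewrite setDE setUIr setUCr setIT (setUidPr xy1) in adj.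
have [sy|sy] := boolP (s \in y.2).
  exists (fun z => if e \in z.2 then (z.1, toggle s z.2) else (toggle e z.1, z.2)).
    exact: reverses_parity_first.
  have -> : e \in x.2 = false by apply: contraNF ex; exact: (subsetP vx).
  by rewrite /code_size /= card_toggle_notin.
exists (fun z => (toggle e z.1, swap s e z.2)); first exact: reverses_parity_inner.
by rewrite /code_size /= card_toggle_notin // card_swap.
Qed.

Lemma code_le_diag y (A : {set 'I_n}) : A \subset y.2 -> y.2 \subset y.1 -> code_le (A, A) y.
Proof.
move=> Ay vy; split => /=; first exact: subset_trans Ay vy.
by move=> i j _ _ /meetsP[d dA]; apply: meets_in; exact: (subsetP Ay).
Qed.

Lemma adjacent_inj (T : {set 'I_n}) s s' e : adjacent T s e -> adjacent T s' e ->
  s \in T -> s' \in T -> s = s'.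
Proof.
move=> a a' sT sT'; apply/eqP/negPn/negP => ss'.
have := adjacentN a' sT ss'; have := adjacentN a sT'; rewrite eq_sym => /(_ ss').
by move: ss'; rewrite /cyc_arc -!val_eqE /=; lia.
Qed.

(* [F] consists of the first elements of the parallel classes of [y]. *)
Lemma parity_involution_bot y : y.2 \subset y.1 -> y.2 != set0 ->
  exists (F : {set 'I_n}) (psi : code -> code), [/\ #|y.2| <= #|F|, code_le (F, F) y &
    forall z, z.2 \subset z.1 -> code_le z y -> z != (F, F) ->
    [/\ (psi z).2 \subset (psi z).1, code_le (psi z) y, (psi z).2 = z.2 /\ psi z != (F, F),
      psi (psi z) = z & odd (code_size (psi z)) = ~~ odd (code_size z)]].
Proof.
move=> vy /set0Pn[d0 d0y].
have next d : exists f, d \in y.2 -> f \in y.1 /\ adjacent y.1 d f.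
  case: (boolP (d \in y.2)) => dy; last by exists d.
  have dT := subsetP vy _ dy.
  have [s [f [/set1P-> fy adj]]] := adjacentP (set11 d) dT.
  by exists f => _; split=> //; move: adj; rewrite (setUidPr _) ?sub1set.
have [nx nxP] := choice next.
pose F := [set nx d | d in y.2].
have nx_inj : {in y.2 &, injective nx}.
  move=> d d' dy dy' e; have [_ a] := nxP d dy; have [_ a'] := nxP d' dy'.
  by rewrite -e in a'; apply: adjacent_inj a a' _ _; exact: (subsetP vy).
have FP f : f \in F -> exists2 s, s \in y.2 & f \in y.1 /\ adjacent y.1 s f.
  by move=> /imsetP[s sy ->]; exists s => //; exact: nxP.
(* If all of [F] are cuts of [z], an element [t] of [z.1] outside [F] would be separated in [z],
   hence in [y], from the first element of its class. *)
have maxF z : z.2 \subset z.1 -> code_le z y -> F \subset z.2 -> z = (F, F).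
  move=> vz zy Fz; have zF : z.1 \subset F.
    apply/subsetP => t tz; have ty := subsetP zy.1 _ tz.
    (* [d] is the last cut of [y] before [t], so [nx d] is the first element of the class of [t]. *)
    have [d [_ [dy /set1P-> adj]]] := adjacentP d0y (set11 t).
    have [fy fadj] := nxP d dy.
    have fF : nx d \in F by apply: imset_f.
    apply: contraT => tF; suff: False by []; have ft : nx d != t by apply: contraNneq tF => <-.
    have /meetsP[m my ftm] := code_le_meets vz zy tz (subsetP Fz _ fF).
    have md : cyc_arc d t m -> m = d by apply: adj; rewrite inE my.
    have td : cyc_arc d (nx d) t -> t = d by exact: fadj.
    have fd : cyc_arc d (nx d) m -> m = d by apply: fadj; exact: (subsetP vy).
    have ddt : t = d -> m = d by move=> e; apply: md; rewrite e arc_id.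
    have ddf : nx d = d -> t = d by move=> e; apply: td; rewrite e arc_id.
    (* If [t = d], then [d] is the only cut of [y], and [[nx d, d)] misses it. *)
    have [e|ntd] := eqVneq t d.
      case/eqP: ft; rewrite e; apply/eqP; apply: contraTT ftm => fd'.
      by rewrite (ddt e) e arc_end.
    have nfd : nx d != d by apply: contra_neq ntd.
    have {td} ntd' : ~~ cyc_arc d (nx d) t by apply: contra_neqN ntd.
    have [em|nmd] := eqVneq m d.
      by rewrite em in ftm; exact: arc_contra1 ft ftm ntd nfd ntd'.
    have {md} nmd' : ~~ cyc_arc d t m by apply: contra_neqN nmd.
    exact: arc_contra2 ft ftm ntd nfd nmd ntd' nmd'.
  have zz : z.2 = F.
    by apply/eqP; rewrite eqEsubset Fz (subset_trans vz).
  have : z.1 = F by apply/eqP; rewrite eqEsubset zF (subset_trans Fz).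
  by move=> e1; rewrite (surjective_pairing z) e1 zz.
(* The chosen element depends on [z.2] alone, which [psi] leaves unchanged; hence [psi] is an
   involution. *)
pose pk (A : {set 'I_n}) := [pick f in F :\: A].
pose psi z : code := if pk z.2 is Some f then (toggle f z.1, z.2) else z.
exists F, psi; split.
- by rewrite card_in_imset.
- split => /=; first by apply/subsetP => f /FP[s _ []].
  move=> i j iF jF _; have [s sy [jy adj]] := FP j jF.
  apply: (meets_in sy); have [->|ij] := eqVneq i j; first exact: arc_id.
  by have [? _ [iy _]] := FP i iF; exact: adjacent_arc adj iy ij.
move=> z vz zy zF; case Ez : (pk z.2) => [f|]; last first.
  case/eqP: zF; apply: maxF => //; apply/subsetP => f fF.
  by move: Ez; rewrite /pk; case: pickP => // H _; have := H f; rewrite inE fF andbT => /negPn.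
have psiE : psi z = (toggle f z.1, z.2) by rewrite /psi Ez.
have /setDP[fF fz] : f \in F :\: z.2.
  by move: Ez; rewrite /pk; case: pickP => // g gF [<-].
have [s sy [fy adj]] := FP f fF.
have [vt lt] := code_le_toggle vz zy sy fy adj fz.
rewrite psiE; split => //=.
- split=> //; apply: contraNneq zF => -[_ e2].
  by apply/eqP; apply: maxF; rewrite // e2.
- by rewrite /psi /= Ez toggleK -surjective_pairing.
- by rewrite /code_size /= !oddD odd_card_toggle addNb.
Qed.

End Codes.

(** * Labels of parallel classes *)

Section Labels.
Variable n : nat.
Implicit Types (D T : {set 'I_n}) (i j : 'I_n).

Definition below D i : nat := #|[set d in D | d < i]|.

(* The elements of a cyclic interval between two consecutive elements of [D]
   have the same label; those above all of [D] wrap around to label 0. *)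
Definition label D i : nat := below D i %% #|D|.

Lemma below_le D i : below D i <= #|D|.
Proof. by apply/subset_leq_card/subsetP => d; rewrite inE => /andP[]. Qed.

Lemma below_mono D i j : i <= j -> below D i <= below D j.
Proof.
move=> ij; apply/subset_leq_card/subsetP => d; rewrite !inE => /andP[-> di] /=.
exact: leq_trans di ij.
Qed.

Lemma below_between D i j : i < j ->
  below D j = below D i + #|[set d in D | i <= d < j]|.
Proof.
move=> ij; rewrite /below -(cardsID [set d : 'I_n | d < i] [set d in D | d < j]).
congr (_ + _); apply: eq_card => d; rewrite !inE; case: (d \in D) => //=; lia.
Qed.

Lemma meets_ltn D i j : i < j -> meets D i j = (below D i < below D j).
Proof.
move=> ij; rewrite (below_between D ij) -[ltnLHS]addn0 ltn_add2l card_gt0.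
apply/meetsP/set0Pn => [[d dD dij]|[d H]]; exists d => //.
- by rewrite inE dD; move: dij; rewrite /cyc_arc; lia.
- by move: H; rewrite inE => /andP[].
- by move: H; rewrite inE /cyc_arc => /andP[_ ->].
Qed.

(** The wrapping arc [[j, i)] is the complement of [[i, j)], so it misses [D] only if all cuts lie
    in [[i, j)]. *)
Lemma meets_gtn D i j : i < j -> meets D j i = (below D j < below D i + #|D|).
Proof.
move=> ij; rewrite (below_between D ij) ltn_add2l; set S := [set d in D | _].
have SD : S \subset D by apply/subsetP => d; rewrite inE => /andP[].
rewrite -(cardsID S D) (setIidPr SD) -[ltnLHS]addn0 ltn_add2l card_gt0.
apply/meetsP/set0Pn => [[d dD dij]|[d H]]; exists d => //.
- by rewrite !inE dD; move: dij; rewrite /cyc_arc; lia.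
- by move: H; rewrite !inE => /andP[].
- by move: H; rewrite !inE /cyc_arc => /andP[]; case: (d \in D) => //=; lia.
Qed.

(** For [i < j] and [p] cuts, the numbers [a <= b <= p] of cuts below agree modulo [p] only if
    [a = b], when [[i, j)] has no cut, or [a = 0] and [b = p], when [[j, i)] has none. *)
Lemma label_neq D i j : i != j ->
  (label D i != label D j) = meets D i j && meets D j i.
Proof.
wlog ij : i j / i < j.
  move=> W ij; case: (ltngtP i j) => H; first exact: W.
    by rewrite eq_sym andbC W // eq_sym.
  by move/val_inj: H ij => ->; rewrite eqxx.
move=> _; rewrite meets_ltn // meets_gtn // /label.
move: (below_mono D (ltnW ij)) (below_le D i) (below_le D j).
move: (below D i) (below D j) #|D| => a b p ab ap bp.
have [bp'|pb] := ltnP b p.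
  have ap' : a < p by lia.
  by rewrite !modn_small //; lia.
have -> : b = p by lia.
have [ap'|pa] := ltnP a p; last by have -> : a = p; lia.
by rewrite modnn modn_small //; lia.
Qed.

Lemma label_lt D i : D != set0 -> label D i < #|D|.
Proof. by rewrite -card_gt0; exact: ltn_pmod. Qed.

End Labels.

(** * Transversals of the parallel classes *)

Section Transversals.
Variable n : nat.
Implicit Types (x y : code n) (J : {set 'I_n}).

(** The bases of the uniform matroid of rank [r] on the parallel classes; for [r = 2] this is the
    rank 2 matroid coded by [x]. *)
Definition transversals r x : {set {set 'I_n}} :=
  [set J : {set 'I_n} | [&& #|J| == r, J \subset x.1 & dinjectiveb (label x.2) J]].

Lemma transversalsP r x J : reflect
  [/\ #|J| = r, J \subset x.1 & {in J &, injective (label x.2)}] (J \in transversals r x).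
Proof.
rewrite inE; apply: (iffP and3P) => [[/eqP ? ? /dinjectiveP]|[-> ? ?]] //.
by split=> //; apply/dinjectiveP.
Qed.

Lemma transversals2 x i j : i != j -> ([set i; j] \in transversals 2 x) =
  [&& i \in x.1, j \in x.1, meets x.2 i j & meets x.2 j i].
Proof.
move=> ij; rewrite -label_neq //; apply/transversalsP/and3P => [[_ H inj]|[iT jT L]].
  split; [by rewrite (subsetP H) // !inE eqxx | by rewrite (subsetP H) // !inE eqxx orbT|].
  by apply: contra_neq ij => /inj; apply; rewrite !inE eqxx ?orbT.
split; first by rewrite cards2 ij.
  by apply/subsetP => m; rewrite !inE => /orP[]/eqP->.
move=> a b; rewrite !inE => /orP[]/eqP-> /orP[]/eqP-> // e; first by rewrite e eqxx in L.
by rewrite e eqxx in L.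
Qed.

(** Labels are below [#|x.2|]. Without cuts every label is 0, which two elements of [J] exclude. *)
Lemma transversal_card x J : 2 <= #|J| -> {in J &, injective (label x.2)} -> #|J| <= #|x.2|.
Proof.
move=> J2 inj; have [x0|x0] := eqVneq x.2 set0.
  have [i [j [iJ jJ ij]]] : exists i j, [/\ i \in J, j \in J & i != j].
    by have /card_gt1P[i [j [? ? ?]]] := J2; exists i, j.
  have L i' : label x.2 i' = 0.
    have := below_le x.2 i'; rewrite /label x0 cards0; lia.
  by move: ij; rewrite (inj i j) ?L ?eqxx.
pose f (i : 'I_n) := Ordinal (label_lt i x0).
have fi : {in J &, injective f} by move=> i j iJ jJ /(congr1 val); exact: inj.
by rewrite -(card_in_imset fi) (leq_trans (max_card _)) ?card_ord.
Qed.

(** Each of the two arcs between distinct cuts contains the cut at which it starts. *)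
Lemma cut_label_inj x : {in x.2 &, injective (label x.2)}.
Proof.
move=> i j iD jD e; apply/eqP/negPn/negP => ij.
have := label_neq x.2 ij; rewrite e eqxx => /esym/negbT/negP[].
by rewrite (meets_in iD (arc_refl _ _)) (meets_in jD (arc_refl _ _)).
Qed.

Lemma clique_card x J : 2 <= #|J| ->
  (forall i j, i \in J -> j \in J -> i != j -> [set i; j] \in transversals 2 x) ->
  #|J| <= #|x.2|.
Proof.
move=> J2 H; apply: transversal_card => // i j iJ jJ e.
apply/eqP/negPn/negP => ij.
have := H i j iJ jJ ij; rewrite transversals2 // -label_neq //.
by rewrite e eqxx !andbF.
Qed.

(** The cuts of [x] are still pairwise nonparallel in [y]. *)
Lemma code_le_card x y : x.2 \subset x.1 -> 2 <= #|x.2| -> code_le x y -> #|x.2| <= #|y.2|.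
Proof.
move=> vx x2 xy; apply: clique_card => // i j iD jD ij; rewrite transversals2 //.
have iT := subsetP vx _ iD; have jT := subsetP vx _ jD.
by rewrite !(subsetP xy.1) // !(code_le_meets vx xy).
Qed.

Lemma code_size_lt x y : x.2 \subset x.1 -> y.2 \subset y.1 -> 2 <= #|x.2| ->
  code_le x y -> x != y -> code_size x < code_size y.
Proof.
move=> vx vy x2 xy; have c1 := subset_leq_card xy.1; have c2 := code_le_card vx x2 xy.
rewrite ltn_neqAle leq_add // andbT; apply: contra_neq; rewrite /code_size => e.
have e1 : x.1 = y.1 by apply/eqP; rewrite eqEcard xy.1; lia.
have e2 : x.2 = y.2 by apply/eqP; rewrite eqEcard (code_le_same vx vy) //; lia.
by rewrite (surjective_pairing x) (surjective_pairing y) e1 e2.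
Qed.

(** Of two cuts, take the later one as seen from [t]. It is not parallel to [t], so every nonloop
    lies in a basis. *)
Lemma later_cut (D : {set 'I_n}) (t : 'I_n) : 2 <= #|D| ->
  exists e, [/\ e \in D, e != t & meets D t e].
Proof.
case/card_gt1P => d1 [d2 [d1D d2D d12]].
have [td|td] := boolP (cyc_arc t d1 d2 && (d1 != t)).
  by case/andP: td => td dt; exists d1; split=> //; apply: meets_in d2D td.
exists d2; split=> //; last apply: (meets_in d1D); move: td d12; rewrite /cyc_arc -!val_eqE /=; lia.
Qed.

(** In the converse, the delicate case is an arc [[i, j)] whose complement has no cut. Then a cut
    [e] not parallel to [i] lies in [[i, j)], and the pair of [i] and [e] gives a cut of [y] in
    [[i, e)]. *)
Lemma code_le_transversals x y : x.2 \subset x.1 -> 2 <= #|x.2| ->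
  code_le x y <-> transversals 2 x \subset transversals 2 y.
Proof.
move=> vx x2; split => [xy|sub].
  apply/subsetP => J JU; have [/eqP /cards2P[i [j [ij eJ]]] _ _] := transversalsP _ _ _ JU.
  move: JU; rewrite eJ !transversals2 // => /and4P[iT jT mij mji].
  by rewrite !(subsetP xy.1) // !xy.2.
have H i j : i != j -> i \in x.1 -> j \in x.1 -> meets x.2 i j -> meets x.2 j i ->
    [/\ i \in y.1, j \in y.1, meets y.2 i j & meets y.2 j i].
  move=> ij iT jT mij mji; apply/and4P; rewrite -transversals2 //; apply: (subsetP sub).
  by rewrite transversals2 // iT jT mij.
have K t : t \in x.1 -> exists e, [/\ e \in x.2, e != t, t \in y.1 & meets y.2 t e].
  move=> tT; have [e [eD et te]] := later_cut t x2; exists e.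
  have et' := meets_in eD (arc_refl e t); have eT := subsetP vx _ eD.
  have te' : t != e by rewrite eq_sym.
  case: (H t e te' tT eT te et') => h1 h2 h3 h4.
  by split.
split; first by apply/subsetP => t /K[e []].
move=> i j iT jT mij; have [e [eD ei _ mie]] := K i iT.
have [<-|ij] := eqVneq i j.
  by have /meetsP[d dy _] := mie; apply: meets_in dy (arc_id _ _).
have [mji|mji] := boolP (meets x.2 j i); first by have [] := H i j ij iT jT mij mji.
have ije : cyc_arc i j e.
  by apply: arc_compl => //; apply: contra mji; exact: meets_in.
by apply: meets_sub mie => d; apply: arc_trans_l ije; rewrite eq_sym.
Qed.

(** If every cut had the label of some element of [J], choosing such elements would embed the cuts
    into [J], which is too small. *)
Lemma transversal_extend1 m x J : x.2 \subset x.1 -> J \in transversals m x -> m < #|x.2| ->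
  exists2 d, d \notin J & d |: J \in transversals m.+1 x.
Proof.
move=> vx /transversalsP[cJ JT inj] mp.
have [d dD dJ] : exists2 d, d \in x.2 & forall j, j \in J -> label x.2 j <> label x.2 d.
  apply: contrapT => no.
  have g d : exists j, d \in x.2 -> j \in J /\ label x.2 j = label x.2 d.
    case: (boolP (d \in x.2)) => dD; last by exists d.
    apply: contrapT => no'; apply: no; exists d => // j jJ e; apply: no'; by exists j.
  have [h hP] := choice g.
  have hi : {in x.2 &, injective h}.
    move=> a b aD bD e; apply: (cut_label_inj aD bD).
    by rewrite -(hP a aD).2 -(hP b bD).2 e.
  move: mp; rewrite ltnNge -cJ -(card_in_imset hi) => /negP; apply.
  by apply/subset_leq_card/subsetP => _ /imsetP[a aD ->]; have [] := hP a aD.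
have dnJ : d \notin J by apply/negP => /dJ; apply.
exists d => //; apply/transversalsP; split.
- by rewrite cardsU1 dnJ cJ.
- by apply/subsetP => m' /setU1P[->|/(subsetP JT)//]; exact: subsetP vx _ _.
move=> a b /setU1P[->|aJ] /setU1P[->|bJ] // e; last exact: inj.
  by case: (dJ b bJ).
by case: (dJ a aJ).
Qed.

Lemma transversal_extend m r x J : x.2 \subset x.1 -> J \in transversals m x ->
  m <= r <= #|x.2| -> exists2 K, K \in transversals r x & J \subset K.
Proof.
move=> vx; move: {2}(r - m) (erefl (r - m)) => q.
elim: q m J => [|q IHq] m J e JU /andP[mr rp].
  by exists J => //; have <- : m = r by lia.
have [|d dJ dU] := transversal_extend1 vx JU; first by lia.
have [||K KU sK] := IHq _ _ _ dU; [lia|lia|].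
by exists K => //; apply: subset_trans sK; exact: subsetUr.
Qed.

Lemma transversals_neq0 r x : x.2 \subset x.1 -> r <= #|x.2| ->
  exists K, K \in transversals r x.
Proof.
move=> vx rp; have [||K KU _] := @transversal_extend 0 r x set0 vx; last by exists K.
  apply/transversalsP; split; rewrite ?cards0 ?sub0set // => i j.
  by rewrite inE.
by rewrite rp.
Qed.

Lemma transversals_pairs r x : x.2 \subset x.1 -> 2 <= r <= #|x.2| ->
  [set I : {set 'I_n} | (#|I| == 2) & [exists J in transversals r x, I \subset J]] =
  transversals 2 x.
Proof.
move=> vx /andP[r2 rp]; apply/setP => I; rewrite inE; apply/andP/idP.
  case=> /eqP cI /exists_inP[J /transversalsP[_ JT inj] IJ].
  apply/transversalsP; split=> //; first exact: subset_trans IJ JT.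
  by move=> i j iI jI; apply: inj; exact: subsetP IJ _ _.
move=> IU; have [cI _ _] := transversalsP _ _ _ IU; rewrite cI; split=> //.
have [|K KU IK] := transversal_extend vx IU (r := r); first by rewrite r2.
by apply/exists_inP; exists K.
Qed.

End Transversals.

(** * Realisation of codes by matrices *)

Local Open Scope ring_scope.

Section Plucker.
Variables (R : realType) (n : nat).
Implicit Types (J : {set 'I_n}).

Lemma increasingP k (f : {ffun 'I_k -> 'I_n}) :
  reflect (forall i j : 'I_k, (i < j)%N -> (f i < f j)%N) (increasing f).
Proof.
by apply: (iffP forallP) => [H i j ij|H i]; [have /forallP/(_ j)/implyP := H i; apply|
  apply/forallP => j; apply/implyP/H].
Qed.

Lemma increasing_inj k (f : {ffun 'I_k -> 'I_n}) : increasing f -> injective f.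
Proof.
move=> /increasingP inc i j e; apply: val_inj.
by case: (ltngtP i j) => // /inc; rewrite e ltnn.
Qed.

Lemma increasing_enum k J : #|J| = k ->
  exists2 f : {ffun 'I_k -> 'I_n}, increasing f & [set f i | i : 'I_k] = J.
Proof.
move=> <-; exists [ffun i => enum_val i]; last first.
  apply/setP => j; apply/imsetP/idP => [[i _ ->]|jJ]; first by rewrite ffunE enum_valP.
  by exists (enum_rank_in jJ j); rewrite // ffunE enum_rankK_in.
have inc_A : sorted ltn (map val (enum J)).
  rewrite -[enum _](eq_filter (mem_enum _)) -(eq_filter (mem_map val_inj _)) -filter_map.
  by rewrite (sorted_filter ltn_trans) // unlock val_ord_enum iota_ltn_sorted.
apply/increasingP => i j ij; rewrite !ffunE.
have sz (l : 'I_#|J|) : (l < size (map val (enum J)))%N by rewrite size_map -cardE.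
have x0 := enum_val i.
have E (l : 'I_#|J|) : (enum_val l : nat) = nth 0%N (map val (enum J)) l.
  by rewrite (nth_map (enum_default l)) -?cardE.
by rewrite !E (sorted_ltn_nth ltn_trans) ?inE.
Qed.

Lemma basesP k (A : 'M[R]_(k, n)) J : reflect
  (exists f, [/\ increasing f, plucker A f != 0 & [set f i | i : 'I_k] = J]) (J \in bases A).
Proof.
apply: (iffP imsetP) => [[f]|[f [inc nz <-]]].
  by rewrite inE => /andP[inc nz] ->; exists f.
by exists f; rewrite // inE inc.
Qed.

Lemma colsub1 k (A : 'M[R]_(k, n)) m (f : 'I_m -> 'I_n) :
  colsub f A = A *m colsub f 1%:M.
Proof. by rewrite mulmx_colsub mulmx1. Qed.

Lemma plucker_row_free k (A : 'M[R]_(k, n)) f : plucker A f != 0 -> row_free A.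
Proof.
rewrite -unitfE -unitmxE /plucker => /mxrank_unit rk.
rewrite /row_free eqn_leq rank_leq_row -{1}rk colsub1; exact: mxrankM_maxl.
Qed.

(** Full rank gives independent columns in some order. Their minor is the sorted minor times the
    determinant of a selection matrix, so the sorted one is nonzero too. *)
Lemma bases_neq0 k (A : 'M[R]_(k, n)) : row_free A -> exists J, J \in bases A.
Proof.
move=> Af; have Atf : row_full A^T by rewrite /row_full mxrank_tr.
pose g := fullrankfun Atf.
have ug : \det (colsub g A) != 0.
  by rewrite -det_tr trmx_mxsub -unitfE -unitmxE fullrowsub_unit.
pose J := [set g i | i : 'I_k].
have cJ : #|J| = k by rewrite card_imset ?card_ord //; exact: fullrankfun_inj.
have [f inc eJ] := increasing_enum cJ; exists J; apply/basesP; exists f; split=> //.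
have /choice[t tP] i : exists j, g i = f j.
  have : g i \in J by apply: imset_f.
  by rewrite -eJ => /imsetP[j _ ->]; exists j.
apply: contra ug => /eqP pf; have -> : colsub g A = colsub t (colsub f A).
  by apply/matrixP => i j; rewrite !mxE tP.
have -> : colsub t (colsub f A) = colsub f A *m colsub t 1%:M.
  by rewrite mulmx_colsub mulmx1.
by rewrite det_mulmx -/(plucker A f) pf mul0r.
Qed.

Lemma card_basis k (A : 'M[R]_(k, n)) J : J \in bases A -> #|J| = k.
Proof. by case/basesP => f [inc _ <-]; rewrite card_imset ?card_ord //; exact: increasing_inj. Qed.

End Plucker.

(** * Block Vandermonde matrices *)

Section BlockVandermonde.
Variables (R : realType) (n : nat) (x : code n).

Let D := x.2.
Let T := x.1.

(* Elements above all cuts wrap around to the first class; the sign keeps the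
   minors nonnegative. *)
Definition block_scale r (j : 'I_n) : R :=
  if j \notin T then 0 else if below D j == #|D| then (-1) ^+ r.-1 else 1.

(** The nodes are the labels, so columns of one class agree up to sign. *)
Definition block_vandermonde r : 'M[R]_(r, n) :=
  \matrix_(i, j) ((label D j)%:R ^+ i * block_scale r j).

Lemma plucker_block_vandermonde r (f : {ffun 'I_r -> 'I_n}) :
  plucker (block_vandermonde r) f =
  \prod_(j < r) (block_scale r (f j) *
     \prod_(i < r | (i < j)%N) ((label D (f j))%:R - (label D (f i))%:R)).
Proof.
have -> : plucker (block_vandermonde r) f =
    \det (Vandermonde r (\row_j (label D (f j))%:R) *m diag_mx (\row_j block_scale r (f j))).
  congr (\det _); apply/matrixP => i j; rewrite mul_mx_diag !mxE.
  by [].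
rewrite det_mulmx det_Vandermonde det_diag mulrC big_split; congr (_ * _) => /=.
  by apply: eq_bigr => i _; rewrite mxE.
rewrite (exchange_big_dep xpredT) //=; apply: eq_bigr => j _; apply: eq_bigr => i _.
by rewrite !mxE.
Qed.

(** The differences of labels are positive, except that the last column may wrap around to label 0.
    It then contributes [r - 1] negative differences, which its scale [(-1) ^+ r.-1] compensates. *)
Lemma plucker_block_vandermonde_gt0 r (f : {ffun 'I_r -> 'I_n}) : increasing f ->
  (forall j, f j \in T) -> injective (fun j => label D (f j)) ->
  0 < plucker (block_vandermonde r) f.
Proof.
move=> /increasingP inc fT inj; rewrite plucker_block_vandermonde.
apply: prodr_gt0 => j _; rewrite /block_scale fT /=.
have lab_lt i : (below D (f i) < #|D|)%N -> label D (f i) = below D (f i).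
  by move=> H; rewrite /label modn_small.
have lab_top i : below D (f i) = #|D| -> label D (f i) = 0%N.
  by move=> H; rewrite /label H modnn.
have [top|ntop] := eqVneq (below D (f j)) #|D|; last first.
  have lj : (below D (f j) < #|D|)%N by rewrite ltn_neqAle ntop below_le.
  rewrite mul1r; apply: prodr_gt0 => i ij; rewrite subr_gt0 ltr_nat.
  have le_ij := below_mono D (ltnW (inc _ _ ij)).
  have : label D (f i) != label D (f j) by apply: contraTneq ij => /inj->; rewrite ltnn.
  by rewrite ltn_neqAle !lab_lt ?(leq_ltn_trans le_ij) // => ->.
(* A later column would wrap around as well and repeat the label 0. *)
have last_j (i : 'I_r) : (i <= j)%N.
  rewrite leqNgt; apply/negP => ji; have := below_mono D (ltnW (inc _ _ ji)).
  rewrite top => Hi; have ti : below D (f i) = #|D| by apply/eqP; rewrite eqn_leq below_le.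
  by move: ji; rewrite (inj j i) ?ltnn // !lab_top.
have rj : r.-1 = j :> nat.
  have jr := ltn_ord j; have r1 : (r.-1 < r)%N by rewrite ltn_predL (leq_ltn_trans _ jr).
  by have := last_j (Ordinal r1); move: jr r1; rewrite /=; clear; lia.
rewrite lab_top //.
have -> : \prod_(i < r | (i < j)%N) (0%:R - (label D (f i))%:R) =
    (-1) ^+ j * \prod_(i < r | (i < j)%N) (label D (f i))%:R :> R.
  transitivity (\prod_(i in [pred i : 'I_r | (i < j)%N]) - (label D (f i))%:R : R).
    by apply: eq_bigr => i _; rewrite sub0r.
  rewrite prodrN; congr (_ ^+ _ * _).
  by rewrite -sum1_card (big_ord_narrow (ltnW (ltn_ord j))) sum1_card card_ord.
rewrite rj mulrA -exprD addnn -muln2 exprM sqrr_sign mul1r.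
apply: prodr_gt0 => i ij; rewrite ltr0n lt0n.
have : label D (f i) != label D (f j) by apply: contraTneq ij => /inj->; rewrite ltnn.
by rewrite (lab_top j).
Qed.

Lemma plucker_block_vandermonde_neq0 r (f : {ffun 'I_r -> 'I_n}) : increasing f ->
  (plucker (block_vandermonde r) f != 0 ->
    (forall j, f j \in T) /\ injective (fun j => label D (f j))).
Proof.
move=> inc; rewrite plucker_block_vandermonde => /prodf_neq0 nz; split=> [j|].
  by have := nz j isT; rewrite /block_scale; case: (f j \in T); rewrite //= mul0r eqxx.
suff H (i j : 'I_r) : (i < j)%N -> label D (f i) != label D (f j).
  move=> i j e; apply: val_inj; case: (ltngtP i j) => // /H; by rewrite e eqxx.
move=> ij; apply/eqP => e; have := nz j isT.
by rewrite (bigD1 i) //= e subrr mul0r mulr0 eqxx.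
Qed.

Lemma positroid_transversals r : D \subset T -> (r <= #|D|)%N ->
  positroid R r (transversals r x).
Proof.
move=> vx rp.
have E : bases (block_vandermonde r) = transversals r x.
  apply/setP => J; apply/basesP/transversalsP => [[f [inc nz <-]]|[cJ JT inj]].
    have [fT finj] := plucker_block_vandermonde_neq0 inc nz.
    split; first by rewrite card_imset ?card_ord //; exact: increasing_inj.
      by apply/subsetP => _ /imsetP[j _ ->].
    by move=> _ _ /imsetP[i _ ->] /imsetP[j _ ->] /finj->.
  have [f inc eJ] := increasing_enum cJ; exists f; split=> //.
  have fJ j : f j \in J by rewrite -eJ imset_f.
  rewrite gt_eqF // plucker_block_vandermonde_gt0 //.
    by move=> j; exact: (subsetP JT).
  by move=> i j /inj e; apply: (increasing_inj inc); exact: e.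
exists (block_vandermonde r) => //; split.
  have [K] := transversals_neq0 vx rp; rewrite -E => /basesP[f [_ nz _]].
  exact: plucker_row_free nz.
move=> f inc; have [->//|nz] := eqVneq (plucker (block_vandermonde r) f) 0.
have [fT finj] := plucker_block_vandermonde_neq0 inc nz.
by rewrite ltW // plucker_block_vandermonde_gt0.
Qed.

End BlockVandermonde.

Lemma imset_ord2 (U : finType) (f : {ffun 'I_2 -> U}) :
  [set f i | i : 'I_2] = [set f ord0; f ord_max].
Proof.
apply/setP => m; rewrite !inE; apply/imsetP/orP => [[i _ ->]|[]/eqP->]; last 2 first.
- by exists ord0.
- by exists ord_max.
by case: (unliftP ord0 i) => [k ->|->]; [right|left]; rewrite // (ord1 k);
  apply/eqP; congr (f _); apply: val_inj.
Qed.

(** * Codes of totally nonnegative matrices with two rows *)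

Section RankTwo.
Variables (R : realType) (n : nat) (A : 'M[R]_(2, n)).
Hypothesis tnnA : tnn A.

Implicit Types (i j k l m s : 'I_n).

Let a0 j : R := A ord0 j.
Let a1 j : R := A ord_max j.
Let cross i j : R := a0 i * a1 j - a0 j * a1 i.
Let T : {set 'I_n} := [set i | (a0 i != 0) || (a1 i != 0)].
(** The cuts: nonloops not parallel to their cyclic successor in [T]. *)
Let D : {set 'I_n} := [set i in T |
  [exists j in T, [forall m in T, cyc_arc i j m ==> (m == i)] && (cross i j != 0)]].

Let crossC i j : cross i j = - cross j i.
Proof. by rewrite /cross opprB. Qed.

Let plucker_cross (f : {ffun 'I_2 -> 'I_n}) : plucker A f = cross (f ord0) (f ord_max).
Proof.
rewrite /plucker (expand_det_row _ ord0) !big_ord_recl big_ord0 addr0 /cofactor !det_mx11 !mxE.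
rewrite /= expr0 expr1 mul1r mulN1r mulrN /cross /a0 /a1.
by congr (A _ (f _) * A _ (f _) - A _ (f _) * A _ (f _)); apply: val_inj.
Qed.

Let cross_ge0 i j : (i < j)%N -> 0 <= cross i j.
Proof.
move=> ij; pose f := [ffun k : 'I_2 => if k == ord0 then i else j].
have inc : increasing f.
  apply/increasingP => k l kl; rewrite !ffunE -!val_eqE /=.
  by have := ltn_ord l; case: ifP => [_|]; case: ifP; lia.
by have [_ /(_ f inc)] := tnnA; rewrite plucker_cross !ffunE eqxx.
Qed.

Let parallelP i j : i \in T -> cross i j = 0 -> exists c, a0 j = c * a0 i /\ a1 j = c * a1 i.
Proof.
move=> iT e; have E : a0 i * a1 j = a0 j * a1 i by exact: subr0_eq.
move: iT; rewrite inE => /orP[] nz.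
  exists (a0 j / a0 i); split; first by rewrite divfK.
  by apply: (mulfI nz); rewrite E mulrA [a0 i * _]mulrC divfK.
exists (a1 j / a1 i); split; last by rewrite divfK.
by apply: (mulfI nz); rewrite mulrC -E mulrA [a1 i * _]mulrC divfK // mulrC.
Qed.

Let parallel_trans j i k : j \in T -> cross i j = 0 -> cross j k = 0 -> cross i k = 0.
Proof.
move=> jT ij jk; have [c [k0 k1]] := parallelP jT jk.
have -> : cross i k = cross i j * c by rewrite /cross k0 k1; ring.
by rewrite ij mul0r.
Qed.

Let succ i : i \in T -> exists2 s, s \in T & adjacent T i s.
Proof.
move=> iT; have [_ [s [/set1P-> sT adj]]] := adjacentP (set11 i) iT.
by exists s => //; move: adj; rewrite (setUidPr _) ?sub1set.
Qed.

Let noncut_parallel i s : i \in T -> s \in T -> adjacent T i s -> i \notin D -> cross i s = 0.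
Proof.
move=> iT sT adj; rewrite inE iT /= => /exists_inPn/(_ s sT).
rewrite negb_and negbK => /orP[/forall_inPn[m mT]|/eqP//].
by rewrite negb_imply => /andP[/(adj m mT)->]; rewrite eqxx.
Qed.

(** Walk from [i] to [j] through successive elements of [T]: as no cut is passed, each step joins
    parallel columns. *)
Let nomeets_parallel i j : i \in T -> j \in T -> i != j -> ~~ meets D i j -> cross i j = 0.
Proof.
move: {2}(dist i j) (leqnn (dist i j)) => q.
elim: q i => [|q IHq] i dq iT jT ij nm.
  move: dq ij; rewrite /dist -val_eqE /=; case: ifP; have := ltn_ord i; lia.
have [s sT adj] := succ iT.
have iD : i \notin D by apply: contra nm => iD; apply: meets_in iD (arc_refl _ _).
have is0 := noncut_parallel iT sT adj iD.
have [<-//|sj] := eqVneq s j.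
have nsj : ~~ cyc_arc i s j by apply: adjacentN adj jT _; rewrite eq_sym.
have si : s != i.
  by apply: contraNneq nsj => ->; exact: arc_id.
have ijs : cyc_arc i j s.
  by move: nsj ij sj; rewrite /cyc_arc -!val_eqE /=; clear; lia.
apply: (parallel_trans sT is0); apply: (IHq _ _ sT jT sj).
  by have := arc_dist_l ijs si; clear -dq; lia.
by apply: contra nm; apply: meets_sub => d; exact: arc_trans_r ijs.
Qed.

(** A cut in the arc would be parallel to its successor, which is in the arc or equals [j]. *)
Let parallel_nomeets i j : i \in T -> j \in T -> i != j ->
  (forall m, m \in T -> cyc_arc i j m -> cross i m = 0) -> cross i j = 0 -> ~~ meets D i j.
Proof.
move=> iT jT ij H pij; apply/negP => /meetsP[d].
rewrite inE => /andP[dT /exists_inP[s sT /andP[/forall_inP adj /eqP ds]]] ijd.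
apply: ds; have pd := H d dT ijd.
have pdi : cross d i = 0 by rewrite crossC pd oppr0.
apply: (parallel_trans iT pdi); have [->//|sj] := eqVneq s j.
apply: H => //; have dj : d != j by apply: contraTneq ijd => ->; exact: arc_end.
have nj : ~~ cyc_arc d s j.
  by apply: contra dj => dsj; rewrite eq_sym; apply: (implyP (adj j jT)).
have [si|si] := eqVneq s i; first by rewrite si arc_refl.
by move: ijd nj dj sj; rewrite /cyc_arc -!val_eqE /=; clear; lia.
Qed.

(** Total nonnegativity makes the classes cyclic intervals. If column [j] is [c] times column [i]
    and some [a] in between is not parallel to [i], then [cross a j = - (c * cross i a)] forces
    [c <= 0]. Comparing signs, every nonloop in [[j, i)] is parallel to [j], so that arc has no
    cut. *)
Let cross_neq0 i j : (i < j)%N ->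
  (cross i j != 0) = [&& i \in T, j \in T, meets D i j & meets D j i].
Proof.
move=> lij; have ij : i != j by rewrite -val_eqE /= ltn_eqF.
have z k l : k \notin T -> cross k l = 0.
  by rewrite inE negb_or !negbK /cross => /andP[/eqP-> /eqP->]; rewrite mul0r mulr0 subr0.
apply/idP/and4P => [nz|[iT jT mij mji]].
  have iT : i \in T by apply: contraNT nz => /z->.
  have jT : j \in T by apply: contraNT nz => /z zj; rewrite crossC zj oppr0.
  split=> //; apply: contraNT nz => nm.
    by rewrite (nomeets_parallel iT jT ij nm).
  by rewrite crossC (nomeets_parallel jT iT _ nm) ?oppr0 // eq_sym.
apply/negP => /eqP pij; have pji : cross j i = 0 by rewrite crossC pij oppr0.
have [c [c0 c1]] := parallelP iT pij.
have [[a [aT ija pia]]|none] := pselect (exists a, [/\ a \in T, cyc_arc i j a & cross i a != 0]);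
    last first.
  suff : ~~ meets D i j by rewrite mij.
  apply: parallel_nomeets => // m mT ijm; apply/eqP/negPn/negP => nz.
  by apply: none; exists m.
suff : ~~ meets D j i by rewrite mji.
apply: parallel_nomeets => //; first by rewrite eq_sym.
move=> b bT jib; have [->|bj] := eqVneq b j; first by rewrite /cross subrr.
have ai : a != i by apply: contraNneq pia => ->; rewrite /cross subrr.
have [ia aj] : (i < a)%N /\ (a < j)%N.
  by move: ija lij ai; rewrite /cyc_arc -val_eqE /=; clear; lia.
have pa : 0 < cross i a by rewrite lt_def pia cross_ge0.
have paj := cross_ge0 aj.
have cle0 : c <= 0.
  rewrite leNgt; apply/negP => cgt0; move: paj.
  have -> : cross a j = - (c * cross i a) by rewrite /cross c0 c1; ring.
  by rewrite oppr_ge0 leNgt mulr_gt0.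
have jbE : cross j b = c * cross i b by rewrite /cross c0 c1; ring.
have [jb|jb] := ltnP j b.
  apply/le_anti; rewrite (cross_ge0 jb) andbT jbE.
  by apply: mulr_le0_ge0 => //; apply: cross_ge0; exact: ltn_trans jb.
have bi : (b < i)%N.
  by move: jib jb bj lij; rewrite /cyc_arc -val_eqE /=; clear; lia.
have bjl : (b < j)%N := ltn_trans bi lij.
have := cross_ge0 bjl; rewrite crossC oppr_ge0 => le0.
apply/le_anti; rewrite le0 /= jbE; apply: mulr_le0 => //.
by rewrite crossC oppr_le0 cross_ge0.
Qed.

Lemma bases_rank2 : exists x : code n,
  [/\ x.2 \subset x.1, (2 <= #|x.2|)%N & bases A = transversals 2 x].
Proof.
exists (T, D); have E : bases A = transversals 2 (T, D).
  apply/setP => J; apply/basesP/idP => [[f [inc nz <-]]|JU].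
    have f01 : (f ord0 < f ord_max)%N by apply: (increasingP _ inc).
    rewrite imset_ord2 transversals2 -?cross_neq0 -?plucker_cross //.
    by rewrite -val_eqE /= ltn_eqF.
  have [cJ _ _] := transversalsP _ _ _ JU.
  have [f inc eJ] := increasing_enum cJ; exists f; split=> //.
  have f01 : (f ord0 < f ord_max)%N by apply: (increasingP _ inc).
  rewrite plucker_cross cross_neq0 //.
  have := JU; rewrite -eJ imset_ord2.
  by rewrite transversals2 // -val_eqE /= ltn_eqF.
split=> //; first by apply/subsetP => i; rewrite inE => /andP[].
have [Af _] := tnnA; have [J] := bases_neq0 Af; rewrite E => /transversalsP[cJ _ inj].
by have := transversal_card _ inj; rewrite cJ; apply.
Qed.

End RankTwo.

(** * Duality of positroids *)

Section Shuffle.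
Variables (R : realType) (k r : nat).

Definition merge_ord (f : 'I_k -> 'I_(k + r)) (g : 'I_r -> 'I_(k + r)) (i : 'I_(k + r)) :=
  match split i with inl a => f a | inr b => g b end.

Variables (f : {ffun 'I_k -> 'I_(k + r)}) (g : {ffun 'I_r -> 'I_(k + r)}).
Hypotheses (incf : increasing f) (incg : increasing g).
Hypothesis compl_fg : [set g b | b : 'I_r] = ~: [set f a | a : 'I_k].

Lemma merge_lshift a : merge_ord f g (lshift r a) = f a.
Proof. by rewrite /merge_ord (unsplitK (inl _ a)). Qed.

Lemma merge_rshift b : merge_ord f g (rshift k b) = g b.
Proof. by rewrite /merge_ord (unsplitK (inr _ b)). Qed.

Let neq_fg a b : f a != g b.
Proof.
apply/eqP => e; have : g b \in ~: [set f a | a : 'I_k] by rewrite -compl_fg imset_f.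
by rewrite -e inE imset_f.
Qed.

Lemma merge_bij : bijective (merge_ord f g).
Proof.
apply: injF_bij => i j; rewrite -(splitK i) -(splitK j).
case: (split i) => a; case: (split j) => b /=; rewrite ?merge_lshift ?merge_rshift => e.
- by rewrite (increasing_inj incf e).
- by have := neq_fg a b; rewrite e eqxx.
- by have := neq_fg b a; rewrite e eqxx.
- by rewrite (increasing_inj incg e).
Qed.

Lemma big_merge (S : Type) (idx : S) (op : Monoid.com_law idx) (F : 'I_(k + r) -> S) :
  \big[op/idx]_i F i = op (\big[op/idx]_a F (f a)) (\big[op/idx]_b F (g b)).
Proof.
rewrite (reindex (merge_ord f g)); last exact/onW_bij/merge_bij.
rewrite big_split_ord; congr (op _ _); apply: eq_bigr => i _.
  by rewrite merge_lshift.
by rewrite merge_rshift.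
Qed.

Let sum_ltn (p : nat) (c : nat) : (c <= p)%N -> (\sum_(i < p) (i < c)%N = c)%N.
Proof.
move=> cp; transitivity (\sum_(i < p | (i < c)%N) 1)%N.
  by rewrite [RHS]big_mkcond; apply: eq_bigr => i _; case: ifP.
by rewrite (big_ord_narrow cp) sum1_card card_ord.
Qed.

(* The number of inversions of the shuffle at position [g b]. *)
Lemma shuffle_count b : (\sum_a (g b < f a) + g b = k + b)%N.
Proof.
have := sum_ltn (ltnW (ltn_ord (g b))); rewrite big_merge /=.
have -> : (\sum_b' (g b' < g b) = b)%N.
  rewrite -[RHS](sum_ltn (ltnW (ltn_ord b))); apply: eq_bigr => b' _; congr nat_of_bool.
  have [H|H|/val_inj->] := ltngtP b' b; last by rewrite ltnn.
    exact: (increasingP _ incg).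
  by apply/negbTE; rewrite -leqNgt ltnW //; exact: (increasingP _ incg).
have : (\sum_(a < k) (f a < g b) + \sum_(a < k) (g b < f a) = k)%N.
  rewrite -big_split /= -[RHS]card_ord -sum1_card; apply: eq_bigr => a _.
  by have := neq_fg a b; rewrite -val_eqE /=; case: ltngtP.
move: (\sum_(a < k) (f a < g b))%N (\sum_(a < k) (g b < f a))%N => s1 s2.
by move: (nat_of_ord (g b)) (nat_of_ord b) => u v; clear; lia.
Qed.

(** By [shuffle_count] the shuffle has [\sum_b (k + b - g b)] inversions, so this is its sign. *)
Let sgn_prod : R := (\prod_b (-1) ^+ g b) * \prod_(b < r) (-1) ^+ (k + b).

Let cross_prod_gt0 : 0 < (\prod_a \prod_b ((g b)%:R - (f a)%:R)) * sgn_prod.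
Proof.
rewrite exchange_big /sgn_prod -!big_split /=; apply: prodr_gt0 => b _.
have -> : \prod_a ((g b)%:R - (f a)%:R) =
    (-1) ^+ (\sum_a (g b < f a)%N) * \prod_a `|(g b)%:R - (f a)%:R| :> R.
  rewrite -prodrXr -big_split /=; apply: eq_bigr => a _.
  have [H|H] := ltnP (g b) (f a); first by rewrite expr1 mulN1r ltr0_norm ?opprK // subr_lt0 ltr_nat.
  by rewrite expr0 mul1r ger0_norm // subr_ge0 ler_nat.
rewrite -[(k + b)%N](shuffle_count b) exprD.
set s2 := (-1) ^+ nat_of_ord (g b); set s1 := (-1) ^+ _; set p := \prod_a _.
have -> : s1 * p * (s2 * (s1 * s2)) = p * (s1 * s1) * (s2 * s2) by ring.
rewrite -!expr2 !sqrr_sign !mulr1; apply: prodr_gt0 => a _.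
by rewrite normr_gt0 subr_eq0 eqr_nat eq_sym -[_ == _]/(f a == g b).
Qed.

(** Compare the Vandermonde determinants at the nodes in natural and in shuffled order: factors
    within [f] or within [g] are positive, and the mixed ones carry the sign. *)
Lemma shuffle_sign : 0 < \det (colsub (merge_ord f g) 1%:M : 'M[R]_(k + r)) * sgn_prod.
Proof.
pose V (h : 'I_(k + r) -> 'I_(k + r)) : 'M[R]_(k + r) := Vandermonde (k + r) (\row_j (h j)%:R).
have detV h : \det (V h) = \prod_(i < k + r) \prod_(j < k + r | (i < j)%N) ((h j)%:R - (h i)%:R).
  rewrite det_Vandermonde; apply: eq_bigr => i _; apply: eq_bigr => j _.
  by rewrite !mxE.
have V0 : 0 < \det (V id).
  by rewrite detV; apply: prodr_gt0 => i _; apply: prodr_gt0 => j ij; rewrite subr_gt0 ltr_nat.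
have Vh : V (merge_ord f g) = V id *m colsub (merge_ord f g) 1%:M.
  by rewrite mulmx_colsub mulmx1; apply/matrixP => i j; rewrite !mxE.
rewrite -(pmulr_rgt0 _ V0) mulrA -det_mulmx -Vh detV big_split_ord /=.
under eq_bigr => a _.
  rewrite big_split_ord /=; under [X in _ * X]eq_bigl => b do rewrite /= ltn_addr //.
  rewrite merge_lshift; under eq_bigr do rewrite merge_lshift.
  under [X in _ * X]eq_bigr do rewrite merge_rshift.
  over.
rewrite big_split /=.
under [X in _ * X * _]eq_bigr => b _.
  rewrite big_split_ord /= big_pred0 ?mul1r; last by move=> a; rewrite ltnNge ltnW ?ltn_addr.
  rewrite merge_rshift; under eq_bigl do rewrite ltn_add2l.
  under eq_bigr do rewrite merge_rshift.
  over.
rewrite mulrAC; apply: mulr_gt0; last first.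
  apply: prodr_gt0 => b _; apply: prodr_gt0 => b' bb'; rewrite subr_gt0 ltr_nat.
  exact: (increasingP _ incg).
rewrite -mulrA; apply: mulr_gt0; last exact: cross_prod_gt0.
apply: prodr_gt0 => a _; apply: prodr_gt0 => a' aa'; rewrite subr_gt0 ltr_nat.
exact: (increasingP _ incf).
Qed.

End Shuffle.

(** * Orthogonal complements and dual positroids *)

Section Duality.
Variable R : realType.

(** If [v] is in the kernel, then [v *m X] has squared norm 0. *)
Lemma gram_unit r m (X : 'M[R]_(r, m)) : row_free X -> X *m X^T \in unitmx.
Proof.
move=> Xf; rewrite -row_free_unit; apply: inj_row_free => v vX0.
have : (v *m X) *m (v *m X)^T = 0 by rewrite trmx_mul mulmxA -(mulmxA v) vX0 mul0mx.
move=> /matrixP/(_ 0 0); rewrite mxE [RHS]mxE.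
under eq_bigr do rewrite [_^T _ _]mxE -expr2.
move=> /eqP; rewrite psumr_eq0 => [/allP sq0|i _]; last exact: sqr_ge0.
apply/eqP; rewrite -(mulmx_free_eq0 v Xf); apply/eqP/rowP => j.
by have := sq0 j (mem_index_enum j); rewrite /= sqrf_eq0 => /eqP->; rewrite mxE.
Qed.

Lemma plucker_mulmx k n (Q : 'M[R]_k) (A : 'M[R]_(k, n)) f :
  plucker (Q *m A) f = \det Q * plucker A f.
Proof. by rewrite /plucker -mulmx_colsub det_mulmx. Qed.

(* Multiplying [A; N] restricted to the reordered columns (f, g) by
   [1, N_f^T; 0, N_g^T] clears the upper right block, since A N^T = 0. *)
Lemma plucker_orthogonal k r (A : 'M[R]_(k, k + r)) (N : 'M[R]_(r, k + r))
    (f : {ffun 'I_k -> 'I_(k + r)}) (g : {ffun 'I_r -> 'I_(k + r)}) :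
  increasing f -> increasing g -> [set g b | b : 'I_r] = ~: [set f a | a : 'I_k] ->
  A *m N^T = 0 ->
  plucker A f * \det (N *m N^T) =
  \det (col_mx A N) * \det (colsub (merge_ord f g) 1%:M) * plucker N g.
Proof.
move=> incf incg compl AN.
have E m1 m2 (X : 'M[R]_(m1, k + r)) (Y : 'M[R]_(m2, k + r)) :
    colsub f X *m (colsub f Y)^T + colsub g X *m (colsub g Y)^T = X *m Y^T.
  apply/matrixP => i j; rewrite !mxE (big_merge incf incg compl) /=.
  by congr (_ + _); apply: eq_bigr => l _; rewrite !mxE.
have S : col_mx A N *m colsub (merge_ord f g) 1%:M =
    block_mx (colsub f A) (colsub g A) (colsub f N) (colsub g N).
  rewrite mulmx_colsub mulmx1; apply/matrixP => i j; rewrite !mxE.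
  by case: (splitP i) => i' ei; rewrite ?mxE; case: (splitP j) => j' ej; rewrite !mxE;
    congr (_ _ _); rewrite -?(merge_lshift f g) -?(merge_rshift f g);
    congr (merge_ord _ _ _); apply: val_inj.
have -> : plucker N g = \det (block_mx 1%:M (colsub f N)^T 0 (colsub g N)^T).
  by rewrite det_ublock det1 mul1r det_tr.
rewrite -det_mulmx S -det_mulmx mulmx_block !mulmx1 !mulmx0 !addr0 !E AN.
by rewrite det_lblock.
Qed.

(** Take the orthogonal complement of [N] with alternating column signs. These signs cancel those of
    the shuffles, so complementary minors agree up to positive factors and one common constant
    [c]. *)
Lemma dual_positroid k r (N : 'M[R]_(r, k + r)) : (0 < k)%N -> tnn N ->
  exists2 A : 'M[R]_(k, k + r), tnn A & bases A = dual_matroid (bases N).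
Proof.
move=> k0 [Nf Npos].
pose E : 'M[R]_(k + r) := diag_mx (\row_j (-1) ^+ j).
have uE : E \in unitmx.
  rewrite unitmxE det_diag unitfE; apply/prodf_neq0 => j _.
  by rewrite mxE signr_eq0.
pose N' := N *m E.
have N'f : row_free N'.
  by rewrite /row_free mxrankMfree ?row_free_unit //.
have [A Af AN] : exists2 A : 'M[R]_(k, k + r), row_free A & A *m N'^T = 0.
  have : exists2 A : 'M[R]_(\rank (kermx N'^T), k + r), row_free A & A *m N'^T = 0.
    exists (row_base (kermx N'^T)); first exact: row_base_free.
    by apply/sub_kermxP; rewrite eq_row_base.
  by rewrite mxrank_ker mxrank_tr (eqP N'f) addnK.
have pN' (g : {ffun 'I_r -> 'I_(k + r)}) : plucker N' g = plucker N g * \prod_b (-1) ^+ g b.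
  have -> : plucker N' g = \det (colsub g N *m diag_mx (\row_b (-1) ^+ g b)).
    by congr (\det _); rewrite /N' /E !mul_mx_diag; apply/matrixP => i j; rewrite !mxE.
  by rewrite det_mulmx det_diag; congr (_ * _); apply: eq_bigr => b _; rewrite mxE.
(* The part of [sgn_prod] that does not depend on [g]; it goes into the constant [c]. *)
pose kap : R := \prod_(b < r) (-1) ^+ (k + b).
have kap2 : kap * kap = 1.
  by rewrite /kap -big_split /= big1 // => b _; rewrite -expr2 sqrr_sign.
have G0 : \det (N' *m N'^T) != 0 by rewrite -unitfE -unitmxE gram_unit.
pose c := kap * \det (col_mx A N') / \det (N' *m N'^T).
have key f g : increasing f -> increasing g ->
    [set g b | b : 'I_r] = ~: [set f a | a : 'I_k] ->
    exists2 w, 0 < w & plucker A f = c * w * plucker N g.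
  move=> incf incg compl; have := plucker_orthogonal incf incg compl AN.
  have := shuffle_sign R incf incg compl; rewrite -/kap.
  set eps := \det _; set sg := \prod_b _ => w0 e.
  exists (eps * (sg * kap)) => //; apply: (mulIf G0); rewrite e pN' -/sg /c.
  move: (\det _) (plucker N g) G0 => G p G0.
  transitivity (\det (col_mx A N') * (eps * (p * sg)) * (kap * kap)); first by rewrite kap2; ring.
  by field.
have complE (J : {set 'I_(k + r)}) p q : (p + q = k + r)%N -> #|J| = p -> #|~: J| = q :> nat.
  by move=> e cJ; apply: (@addnI p); rewrite e -cJ cardsC card_ord.
have c0 : c != 0.
  have [J /basesP[f [inc nz eJ]]] := bases_neq0 Af.
  have cJ : #|~: J| = r by apply: complE (erefl _) _; rewrite (card_basis (A := A)) //; apply/basesP; exists f.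
  have [g incg eg] := increasing_enum cJ.
  have [|w _ e] := key f g inc incg; first by rewrite eJ.
  by apply: contraNneq nz => c0; rewrite e c0 !mul0r.
(* Scaling one row removes [c]; there is a row because [k] is positive. *)
pose Q : 'M[R]_k := diag_mx (\row_i if i == Ordinal k0 then c^-1 else 1).
have dQ : \det Q = c^-1.
  rewrite det_diag (bigD1 (Ordinal k0)) //= mxE eqxx big1 ?mulr1 // => i /negPf ni.
  by rewrite mxE ni.
have {}key f g : increasing f -> increasing g ->
    [set g b | b : 'I_r] = ~: [set f a | a : 'I_k] ->
    exists2 w, 0 < w & plucker (Q *m A) f = w * plucker N g.
  move=> incf incg compl; have [w w0 e] := key f g incf incg compl.
  by exists w => //; rewrite plucker_mulmx dQ e -mulrA mulKf.
have cimg p (f : {ffun 'I_p -> 'I_(k + r)}) : increasing f -> #|[set f i | i : 'I_p]| = p.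
  by move=> inc; rewrite card_imset ?card_ord //; exact: increasing_inj.
exists (Q *m A).
  split.
    have uQ : Q \in unitmx by rewrite unitmxE dQ unitfE invr_eq0.
    by rewrite /row_free mxrankMfree // mxrank_unit.
  move=> f inc; have [g incg eg] := increasing_enum (complE _ _ _ (erefl _) (cimg _ _ inc)).
  have [w w0 ->] := key f g inc incg eg.
  exact: mulr_ge0 (ltW w0) (Npos g incg).
apply/setP => J; apply/basesP/imsetP => [[f [inc nz eJ]]|[K /basesP[g [incg nz eK]] ->]].
  have [g incg eg] := increasing_enum (complE _ _ _ (erefl _) (cimg _ _ inc)).
  exists (~: J); last by rewrite setCK.
  apply/basesP; exists g; split=> //; last by rewrite eg eJ.
  by have [w w0 e] := key f g inc incg eg; apply: contraNneq nz => z; rewrite e z mulr0.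
have [f inc ef] := increasing_enum (complE _ _ _ (addnC _ _) (cimg _ _ incg)).
exists f; split=> //; last by rewrite ef eK.
have [|w w0 ->] := key f g inc incg; first by rewrite ef setCK.
by rewrite mulf_neq0 // gt_eqF.
Qed.

End Duality.

(** * The codes that occur in [P_{n,k}] *)

Lemma inP_codeP (R : realType) (k r : nat) (E : {set {set 'I_(k + r)}}) :
  (0 < k)%N -> (2 <= r)%N ->
  inP R k E <-> exists x : code (k + r),
    [/\ x.2 \subset x.1, (r <= #|x.2|)%N & E = transversals 2 x].
Proof.
move=> k0 r2; split => [/asboolP[M [A [Af _] <-] [[B tB <-] sub _]]|[x [vx rx ->]]].
  have [x [vx _ eB]] := bases_rank2 tB; exists x; split=> //; rewrite eB in sub.
  have [J JA] := bases_neq0 Af.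
  have cJ : #|~: J| = r.
    by apply: (@addnI k); rewrite -{1}(card_basis JA) cardsC card_ord.
  (* All pairs in the complement of a basis lie in [down2], so they are bases of the envelope. *)
  suff: (#|~: J| <= #|x.2|)%N by rewrite cJ.
  apply: clique_card => [|i j iJ jJ ij]; first by rewrite cJ.
  apply: (subsetP sub); rewrite inE cards2 ij /=; apply/exists_inP.
  exists (~: J); first exact: imset_f.
  by apply/subsetP => m /set2P[]->.
have [N tN eN] := positroid_transversals R vx rx.
have [A tA eA] := dual_positroid k0 tN.
have r2x : (2 <= r <= #|x.2|)%N by rewrite r2.
have down : down2 (bases A) = transversals 2 x.
  have -> : down2 (bases A) = [set I : {set 'I_(k + r)} | (#|I| == 2)%N &
      [exists J in transversals r x, I \subset J]].
    rewrite /down2 eA eN; apply/setP => I; rewrite !inE; congr (_ && _).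
    suff -> : dual_matroid (dual_matroid (transversals r x)) = transversals r x by [].
    apply/setP => J; apply/imsetP/idP => [[_ /imsetP[K KU ->] ->]|JU]; first by rewrite setCK.
    by exists (~: J); rewrite ?setCK // imset_f.
  exact: transversals_pairs.
apply/asboolP; exists (bases A); first by exists A.
(* [transversals 2 x] is a positroid already, hence its own envelope. *)
rewrite down; split=> //; apply: positroid_transversals => //.
exact: leq_trans rx.
Qed.

(** * From codes back to positroids *)

Section Main.
Variables (R : realType) (k r : nat).
Hypotheses (k0 : (0 < k)%N) (r2 : (2 <= r)%N).
Let n := (k + r)%N.
Let P := Phat R n k.
Implicit Types (x y : {set 'I_n} * {set 'I_n}) (a b c : Pnk R n k) (z : P).

Let valid x := (x.2 \subset x.1) && (r <= #|x.2|)%N.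

Lemma eulerian_Phat : eulerian (Phat R (k + r) k).
Proof.
have /choice[cod codP] : forall a, exists x, valid x /\ val a = transversals 2 x.
  move=> a; have [x [vx rx e]] := (inP_codeP R (val a) k0 r2).1 (valP a).
  by exists x; rewrite /valid vx rx.
have v1 a : (cod a).2 \subset (cod a).1 by have [/andP[]] := codP a.
have vr a : (r <= #|(cod a).2|)%N by have [/andP[]] := codP a.
have v2 a : (2 <= #|(cod a).2|)%N := leq_trans r2 (vr a).
have leE a b : (Some a <= Some b :> P)%O <-> code_le (cod a) (cod b).
  rewrite code_le_transversals // -(codP a).2 -(codP b).2.
  by rewrite -[(_ <= _)%O]/(a <= b)%O leEsub Order.SetSubsetOrder.leEsubset.
have dec1 x : valid x -> exists a, cod a = x.
  move=> /andP[vx1 vx2].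
  have Ex : inP R k (transversals 2 x) by apply/(inP_codeP R _ k0 r2); exists x.
  pose a : Pnk R n k := exist (fun E => is_true (inP R k E)) _ Ex; exists a; have x2 := leq_trans r2 vx2.
  have /= e : val a = transversals 2 (cod a) := (codP a).2.
  by apply: code_le_anti => //; rewrite code_le_transversals // -e.
have [top topE] : exists a, cod a = (setT, setT).
  by apply: dec1; rewrite /valid /= subxx cardsT card_ord leq_addl.
(* [dec] inverts [cod] on valid codes; on others its value is the arbitrary [top]. *)
have /choice[dec decP] : forall x, exists a, valid x -> cod a = x.
  move=> x; case: (boolP (valid x)) => [/dec1[a e]|_]; first by exists a.
  by exists top.
have cod_inj : injective cod.
  by move=> a b e; apply: val_inj; rewrite (codP a).2 (codP b).2 e.
have codK a : dec (cod a) = a by apply: cod_inj; rewrite decP //; have [] := codP a.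
have valid_le a x : x.2 \subset x.1 -> code_le (cod a) x -> valid x.
  by move=> vx ax; rewrite /valid vx (leq_trans (vr a)) // code_le_card.
have size_ge x : valid x -> (r.*2 <= code_size x)%N.
  move=> /andP[vx rx]; rewrite -addnn leq_add //.
  exact: leq_trans rx (subset_leq_card vx).
(* The smallest valid codes are [(A, A)] with [#|A| = r], of size [2r]; they get rank 1, just above
   [None]. *)
pose rho z : nat := if z is Some a then (code_size (cod a) - r.*2).+1 else 0%N.
have rho_odd x : valid x -> odd (code_size x - r.*2).+1 = ~~ odd (code_size x).
  by move=> vx; rewrite /= oddB ?size_ge // odd_double addbF.
have vcod a : valid (cod a) by have [] := codP a.
have code_ge_set0 a : (cod a).2 != set0 by rewrite -card_gt0; apply: leq_trans (v2 a).
apply: (@eulerian_of_involutions _ _ rho None (Some top)).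
- by [].
- case=> [a|] //; apply/leE; rewrite topE; split => //=.
  by move=> i j _ _ _; apply: meets_in (arc_refl i j); rewrite inE.
- by [].
- case=> [a|] [b|] //; rewrite lt_neqAle => /andP[ab /leE leab].
  rewrite /rho ltnS ltn_sub2rE ?size_ge //; apply: code_size_lt => //.
  by apply: contraNneq ab => /cod_inj->.
- case=> [a|] [b|] //; rewrite lt_neqAle => /andP[ab]; last first.
    (* Any [r] cuts of [b] form an element of rank 1 below [b]. *)
    move=> _; pose A := [set i in take r (enum (cod b).2)].
    have cA : #|A| = r.
      by rewrite cardsE (card_uniqP _) ?take_uniq ?enum_uniq // size_takel // -cardE.
    have Ab : A \subset (cod b).2.
      by apply/subsetP => i; rewrite inE => /mem_take; rewrite mem_enum.
    have vA : valid (A, A) by rewrite /valid /= subxx cA leqnn.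
    exists (Some (dec (A, A))); split=> //.
      by apply/leE; rewrite decP //; exact: code_le_diag.
    by rewrite /rho decP // /code_size /= cA addnn subnn.
  move=> /leE leab; have neq : cod a != cod b by apply: contraNneq ab => /cod_inj->.
  have [|psi H szE] := parity_involution (v1 a) (v1 b) leab neq.
    by apply: contraNneq (code_ge_set0 a) => e; rewrite -subset0 -e.
  have [vp [ap pb] _ _] := H _ (v1 a) (code_le_refl _) leab.
  have vp' := valid_le _ _ vp ap.
  have rhoE : rho (Some (dec (psi (cod a)))) = (rho (Some a)).+1.
    by rewrite /rho decP // szE subSn ?size_ge.
  exists (Some (dec (psi (cod a)))); split=> //; last by apply/leE; rewrite decP.
  rewrite lt_neqAle; apply/andP; split; last by apply/leE; rewrite decP.
  by apply: contra_eq_neq rhoE => <-; rewrite ltn_eqF.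
case=> [a|] [b|] //; rewrite lt_neqAle => /andP[ab].
  move=> /leE leab; have neq : cod a != cod b by apply: contraNneq ab => /cod_inj->.
  have [|psi H _] := parity_involution (v1 a) (v1 b) leab neq.
    by apply: contraNneq (code_ge_set0 a) => e; rewrite -subset0 -e.
  exists (fun z => if z is Some c then Some (dec (psi (cod c))) else None).
  case=> [c|] // /andP[/leE ac /leE cb].
  have [vp [ap pb] pK po] := H _ (v1 c) ac cb; have vp' := valid_le _ _ vp ap.
  split; last by rewrite /rho decP // !rho_odd // po.
    by apply/andP; split; apply/leE; rewrite decP.
  by rewrite decP // pK codK.
(* On an interval that starts at [None], this rank 0 element is exchanged with [(F, F)], whose rank
   is odd. *)
move=> _; have [F [psi [cF Fb H]]] := parity_involution_bot (v1 b) (code_ge_set0 b).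
have vF : valid (F, F) by rewrite /valid /= subxx (leq_trans (vr b)).
have oddF : odd (rho (Some (dec (F, F)))).
  by rewrite /rho decP // rho_odd // /code_size /= addnn odd_double.
exists (fun z => if z is Some c then
  if cod c == (F, F) then None else Some (dec (psi (cod c))) else Some (dec (F, F))).
case=> [c|] /andP[_]; last first.
  move=> _; rewrite decP // eqxx; split=> //.
  by apply/leE; rewrite decP.
move=> /leE cb; case: (eqVneq (cod c) (F, F)) => [e|ne].
  have oc : odd (rho (Some c)) by rewrite -[c]codK e.
  by split=> //; [rewrite -e codK | move: oc => /= ->].
have [vp pb [p2 pF] pK po] := H _ (v1 c) cb ne.
(* The image has enough cuts because its cut set is that of [c]. *)
have vp' : valid (psi (cod c)) by rewrite /valid vp p2 vr.
rewrite decP // (negPf pF); split.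
- by apply/leE; rewrite decP.
- by rewrite pK codK.
- by rewrite /rho decP // !rho_odd // po.
Qed.

End Main.

Theorem theorem5p5 (R : realType) (n k : nat)
  (hk : (1 <= k)%N) (hnk : (2 <= n - k)%N) : eulerian (Phat R n k).
Proof.
have [r r2 ->] : exists2 r, (2 <= r)%N & n = (k + r)%N by exists (n - k)%N; lia.
exact: eulerian_Phat.
Qed.
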